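(* There exists a universal constant $b>0$ such that the following holds for every finite group $G$ with $|G|\ge2$ and every integer $n\ge1$. Let $s$ be the number of conjugacy classes of $G$, let $\rho_1,\dots,\rho_s$ be the nonisomorphic irreducible complex representations of $G$, with $\rho_1$ the trivial representation, let $d_{\rho_j}$ be the dimension of $\rho_j$, and put $\delta_n:=\sum_{j=2}^s d_{\rho_j}^{2n}$. Let $Q$ be the one-step distribution of the paired shuffles random walk on $G\wr S_n$ and let $U$ be the uniform probability measure on $G\wr S_n$ (both defined in the context). Then, for every real $c>0$ for which $$k=\max\left\{n\log n+\tfrac12 n\log(|G|-1)+\tfrac12 n\log(s-1),\ \tfrac12 n\log\delta_n\right\}+2cn$$ is an integer, $$\|Q^{*k}-U\|_{\mathrm{TV}}\ \le\ \tfrac12\left(|G|^n\,n!\right)^{1/2}\|Q^{*k}-U\|_2\ \le\ b\,e^{-2c}.$$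
   Context: The complete monomial group (wreath product) $G\wr S_n$ is the set $G^n\times S_n$, with elements written $(\vec x;\pi)$, $\vec x=(x_1,\dots,x_n)\in G^n$, $\pi\in S_n$, and multiplication $(\vec y;\sigma)(\vec x;\pi)=(y_1x_{\sigma^{-1}(1)},\dots,y_nx_{\sigma^{-1}(n)};\sigma\pi)$. It has $|G|^n n!$ elements and identity $(\vec e;e)$, where $\vec e=(e,\dots,e)$. The paired shuffles measure $Q$ on $G\wr S_n$ is the probability mass function: - $Q(\vec e;e)=\frac{1}{|G|n}$; - $Q(\vec u;e)=\frac{1}{|G|n^2}$ if $\vec u\in G^n$ has exactly one non-identity entry; - $Q(\vec v;\tau)=\frac{2}{|G|n^2}$ if $\tau=(p\ q)\in S_n$ is a transposition, all entries of $\vec v\in G^n$ outside positions $p$ and $q$ are the identity, and the entries in positions $p$ and $q$ are mutually inverse ($v_q=v_p^{-1}$); - $Q(\vec x;\pi)=0$ otherwise. The uniform measure is $U(\vec x;\pi)=\frac{1}{|G|^n n!}$. For functions $P,Q$ on a finite group $\Gamma$: convolution is $P*Q(g)=\sum_{h\in\Gamma}P(gh^{-1})Q(h)$, and $Q^{*k}$ is the $k$-fold convolution power; $\|P-Q\|_{\mathrm{TV}}=\max_{A\subseteq \Gamma}|P(A)-Q(A)|$; $\|P-Q\|_2=\left(\sum_{g\in\Gamma}|P(g)-Q(g)|^2\right)^{1/2}$. Here $\log$ is the natural logarithm. *)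

(* Defs.v *)
From HB Require Import structures.
From mathcomp Require Import all_boot all_order all_algebra all_fingroup.
From mathcomp Require Import all_solvable all_field all_character.
From mathcomp Require Import reals sequences exp.

Set Implicit Arguments.
Unset Strict Implicit.
Unset Printing Implicit Defensive.

Import Order.TTheory GRing.Theory Num.Theory.
Local Open Scope ring_scope.

(* A record rather than an alias of the product type, whose own group
   structure is the direct product. *)
Record wreath (gT : finGroupType) (n : nat) := Wreath {
  wcoord_perm : {ffun 'I_n -> gT} * {perm 'I_n}
}.

HB.instance Definition _ (gT : finGroupType) (n : nat) :=
  [isNew for @wcoord_perm gT n].
HB.instance Definition _ (gT : finGroupType) (n : nat) :=
  [Finite of wreath gT n by <:].

Section WreathGroup.
Variables (gT : finGroupType) (n : nat).
Implicit Types x y z : wreath gT n.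

Definition wcoord x : {ffun 'I_n -> gT} := (wcoord_perm x).1.
Definition wperm x : {perm 'I_n} := (wcoord_perm x).2.

(* (y; s)(x; p) = ((y_i x_(s^-1 i))_i ; s p), where s p means "first p, then s".
   The product of permutations in the library composes in the opposite order:
   (p * s) i = s (p i). *)
Definition wreath_mul y x : wreath gT n :=
  Wreath ([ffun i => (wcoord y i * wcoord x ((wperm y)^-1 i))%g],
          (wperm x * wperm y)%g).

Definition wreath_one : wreath gT n := Wreath ([ffun=> 1%g], 1%g).

Definition wreath_inv x : wreath gT n :=
  Wreath ([ffun i => ((wcoord x (wperm x i))^-1)%g], ((wperm x)^-1)%g).

Lemma wreath_mulA : associative wreath_mul.
Proof.
move=> x y z; congr Wreath; congr pair; last by rewrite /wperm /= mulgA.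
apply/ffunP=> i; rewrite /wcoord /wperm /= !ffunE /= mulgA.
by rewrite invMg permM.
Qed.

Lemma wreath_mul1 : left_id wreath_one wreath_mul.
Proof.
move=> [[x p]]; congr Wreath; congr pair; last by rewrite /wperm /= mulg1.
by apply/ffunP=> i; rewrite /wcoord /wperm /= !ffunE invg1 perm1 mul1g.
Qed.

Lemma wreath_mulV : left_inverse wreath_one wreath_inv wreath_mul.
Proof.
move=> [[x p]]; congr Wreath; congr pair; last by rewrite /wperm /= mulgV.
by apply/ffunP=> i; rewrite /wcoord /wperm /= !ffunE /= invgK mulVg.
Qed.

HB.instance Definition _ := Finite_isGroup.Build (wreath gT n)
  wreath_mulA wreath_mul1 wreath_mulV.

End WreathGroup.

Section FunctionsOnFiniteGroups.
Variables (R : realType) (T : finGroupType).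
Implicit Types P Q : T -> R.

Definition convol P Q : T -> R := fun g => \sum_(h : T) P (g * h^-1)%g * Q h.

(* The 0-th power is the point mass at the identity, so that the first power
   of Q is Q itself. *)
Definition convol_pow Q (k : nat) : T -> R :=
  iter k (convol Q) (fun g => (g == 1%g)%:R).

(* The value 0 taken as base of the maximum is attained at the empty set. *)
Definition tv_dist P Q : R :=
  \big[Num.max/0]_(A : {set T}) `|\sum_(g in A) P g - \sum_(g in A) Q g|.

Definition l2_dist P Q : R := Num.sqrt (\sum_(g : T) `|P g - Q g| ^+ 2).

End FunctionsOnFiniteGroups.

Section PairedShuffles.
Variables (R : realType) (gT : finGroupType) (n : nat).

Definition paired_flip (v : {ffun 'I_n -> gT}) (tau : {perm 'I_n}) : bool :=
  [exists p : 'I_n, exists q : 'I_n,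
    [&& p != q, tau == tperm p q,
        [forall i : 'I_n, (i != p) && (i != q) ==> (v i == 1%g)]
      & v q == ((v p)^-1)%g]].

Definition paired_shuffles (x : wreath gT n) : R :=
  if wperm x == 1%g then
    match #|[set i | wcoord x i != 1%g]| with
    | 0 => (#|gT|%:R * n%:R)^-1
    | 1 => (#|gT|%:R * n%:R ^+ 2)^-1
    | _ => 0
    end
  else if paired_flip (wcoord x) (wperm x) then
    2 / (#|gT|%:R * n%:R ^+ 2)
  else 0.

Definition wreath_unif (x : wreath gT n) : R := (#|gT|%:R ^+ n * n`!%:R)^-1.

End PairedShuffles.

(* Index 0 is the trivial representation; [irr_degree (socle_of_Iirr i)] is the
   dimension of the i-th irreducible representation ['Chi_i] over the algebraic
   complex numbers. *)
Definition delta_irr (gT : finGroupType) (n : nat) : nat :=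
  (\sum_(i : Iirr [set: gT] | i != 0%R)
     irr_degree (socle_of_Iirr i) ^ (2 * n))%N.

Definition num_classes (gT : finGroupType) : nat := #|classes [set: gT]|.

(* Main.v *)
(* Pulling the steps of the walk through the matrix coefficients of the
   irreducible representations of G (Schur orthogonality) turns the return
   probability of the walk into a sum, over the colourings of the positions by
   irreducible representations, of traces of powers of
     W = (number of positions coloured by the trivial representation)
         + sum over ordered pairs of distinct positions p, q of the same colour
           of d^-1 (p q)
   acting on functions on S_n, d being the degree of the common colour.

   The eigenvalues of W are counted without representation theory of S_n.  If
   the range of g is alternating over the classes of a partition of the
   positions into m_j classes inside each colour j, then <g, W g> is at most
   (sum over the positions p of (m_(colour of p) - 1) + number of trivially
   coloured positions) <g, g>.  Hence an eigenfunction for a larger eigenvalue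
   is killed by all the corresponding alternating averages.  A permutation
   without increasing subsequence of length m_j + 1 in the colour j is
   decreasing along the classes of such a partition, and it is then the
   lexicographically largest term of its average; so the eigenfunction is
   determined by its values on the permutations that do have a long increasing
   subsequence.  There are at most sum_A n!/|A|! of those, and summing over the
   colourings gives the bound n^(2J) |G|^J / J! for the multiplicity of the
   eigenvalues of order n (n - J).  Negative eigenvalues are treated in the same
   way, with symmetrizing instead of alternating averages. *)
Require Import Defs.
From mathcomp Require Import all_boot all_order all_algebra all_fingroup.
From mathcomp Require Import all_solvable all_field all_character.
From mathcomp Require Import ring lra reals sequences exp.

Set Implicit Arguments.
Unset Strict Implicit.
Unset Printing Implicit Defensive.

Import Order.TTheory GRing.Theory Num.Theory.
Local Open Scope ring_scope.

(** * Symmetric kernels on a finite type *)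

Section Spectral.
Local Open Scope sesquilinear_scope.
Variables (C : numClosedFieldType) (T : finType).
Implicit Types (h a : T -> T -> C) (f g : T -> C).

Definition kact h f : T -> C := fun x => \sum_y h x y * f y.
Definition dotf f g : C := \sum_x f x * (g x)^*.

Lemma dotfC f g : dotf g f = (dotf f g)^*.
Proof.
by rewrite rmorph_sum; apply: eq_bigr => x _; rewrite rmorphM /= conjCK mulrC.
Qed.

Lemma dotf_ge0 f : 0 <= dotf f f.
Proof. by apply: sumr_ge0 => x _; apply: mul_conjC_ge0. Qed.

Lemma dotf_eq0 f : dotf f f = 0 -> forall x, f x = 0.
Proof.
move=> ff0 x; apply/eqP; rewrite -mul_conjC_eq0; apply/eqP.
by apply: (psumr_eq0P _ ff0) => // y _; apply: mul_conjC_ge0.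
Qed.

Lemma eq_kact h f g : f =1 g -> kact h f =1 kact h g.
Proof. by move=> fg x; apply: eq_bigr => y _; rewrite fg. Qed.

Lemma kactZ h c f x : kact h (fun y => c * f y) x = c * kact h f x.
Proof. by rewrite /kact mulr_sumr; apply: eq_bigr => y _; rewrite mulrCA. Qed.

Lemma kact_sum h (L : finType) (P : pred L) (F : L -> T -> C) x :
  kact h (fun y => \sum_(l | P l) F l y) x = \sum_(l | P l) kact h (F l) x.
Proof. by rewrite exchange_big; apply: eq_bigr => y _; rewrite mulr_sumr. Qed.

Lemma dotf_suml (L : finType) (P : pred L) (F : L -> T -> C) g :
  dotf (fun y => \sum_(l | P l) F l y) g = \sum_(l | P l) dotf (F l) g.
Proof. by rewrite exchange_big; apply: eq_bigr => y _; rewrite mulr_suml. Qed.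

Lemma dotfZl c f g : dotf (fun y => c * f y) g = c * dotf f g.
Proof. by rewrite /dotf mulr_sumr; apply: eq_bigr => y _; rewrite mulrA. Qed.

Lemma eq_dotf f f' g g' : f =1 f' -> g =1 g' -> dotf f g = dotf f' g'.
Proof. by move=> ff gg; apply: eq_bigr => y _; rewrite ff gg. Qed.

(** The enumeration of [T] turns the kernel into a Hermitian matrix. The eigenfunctions come from
    its unitary diagonalization, and the two one-sided unitarity identities give orthonormality and
    completeness. *)
Lemma spectral_basis h :
    (forall x y, h x y \is Num.real) -> (forall x y, h x y = h y x) ->
  exists (u : T -> T -> C) (d : T -> C),
    [/\ forall l, d l \is Num.real,
        forall l x, kact h (u l) x = d l * u l x,
        forall l m, dotf (u l) (u m) = (l == m)%:R
      & forall x y, \sum_l u l x * (u l y)^* = (x == y)%:R].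
Proof.
move=> h_real h_sym.
pose A : 'M[C]_#|T| := \matrix_(i, j) h (enum_val i) (enum_val j).
have herm : A \is hermsymmx.
  apply: realsym_hermsym.
    by apply/is_hermitianmxP; rewrite expr0 scale1r map_mx_id //;
       apply/matrixP=> i j; rewrite !mxE h_sym.
  by apply/mxOverP=> i j; rewrite mxE.
have /orthomx_spectralP := hermitian_normalmx herm.
have := spectral_unitarymx A; move: (spectralmx A) => P uP.
have := hermitian_spectral_diag_real herm; move: (spectral_diag A) => D rD.
rewrite invmx_unitary // => defA.
have PP1 : P *m P ^t* = 1%:M by apply/unitarymxP.
have PP2 : P ^t* *m P = 1%:M by rewrite -invmx_unitary // mulVmx // unitarymx_unit.
have AP : A *m P ^t* = P ^t* *m diag_mx D by rewrite [in LHS]defA -[LHS]mulmxA PP1 mulmx1.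
exists (fun l x => (P (enum_rank l) (enum_rank x))^*),
  (fun l => D 0 (enum_rank l)); split.
- by move=> l; apply: (mxOverP rD).
- move=> l x; have /matrixP/(_ (enum_rank x) (enum_rank l)) := AP.
  rewrite mul_mx_diag !mxE mulrC => <-; rewrite /kact.
  rewrite (reindex _ (onW_bij _ (enum_val_bij T))) /=.
  by apply: eq_bigr => i _; rewrite !mxE enum_rankK enum_valK.
- move=> l m; have /matrixP/(_ (enum_rank m) (enum_rank l)) := PP1.
  rewrite !mxE (inj_eq enum_rank_inj) eq_sym => <-.
  rewrite /dotf (reindex _ (onW_bij _ (enum_val_bij T))) /=.
  by apply: eq_bigr => i _; rewrite !mxE enum_valK conjCK mulrC.
move=> x y; have /matrixP/(_ (enum_rank x) (enum_rank y)) := PP2.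
rewrite !mxE (inj_eq enum_rank_inj) => <-.
rewrite (reindex _ (onW_bij _ (enum_val_bij T))) /=.
by apply: eq_bigr => i _; rewrite !mxE enum_valK conjCK.
Qed.

Lemma dotf_kactC h f g :
    (forall x y, h x y \is Num.real) -> (forall x y, h x y = h y x) ->
  dotf (kact h f) g = dotf f (kact h g).
Proof.
move=> h_real h_sym; rewrite /dotf /kact.
under eq_bigr do rewrite mulr_suml.
under [RHS]eq_bigr do rewrite rmorph_sum mulr_sumr.
rewrite exchange_big; apply: eq_bigr => x _; apply: eq_bigr => y _.
by rewrite rmorphM /= (CrealP (h_real _ _)) h_sym mulrCA mulrA.
Qed.

(* A function supported on the spectrum above [x] is annihilated by every
   operator [a c] that commutes with [h] and whose range carries the form bound
   [x]; if such a function is determined by its values on [B], there are at most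
   [#|B|] eigenvalues above [x]. *)
Lemma card_eigen_gt h (u : T -> T -> C) (d : T -> C) (s x : C)
    (K : Type) (a : K -> T -> T -> C) (B : {set T}) :
    (forall y z, h y z \is Num.real) -> (forall y z, h y z = h z y) ->
    (forall l, d l \is Num.real) ->
    (forall l y, kact h (u l) y = d l * u l y) ->
    (forall l m, dotf (u l) (u m) = (l == m)%:R) ->
    (forall y z, \sum_l u l y * (u l z)^* = (y == z)%:R) ->
    (forall k f, kact h (kact (a k) f) =1 kact (a k) (kact h f)) ->
    (forall k f, s * dotf (kact h (kact (a k) f)) (kact (a k) f)
                   <= x * dotf (kact (a k) f) (kact (a k) f)) ->
    (forall f, (forall k, kact (a k) f =1 fun=> 0) ->
               (forall y, y \in B -> f y = 0) -> forall y, f y = 0) ->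
  (#|[set l | (x < s * d l)%R]| <= #|B|)%N.
Proof.
move=> h_real h_sym d_real eig orth compl comm form det.
set E := [set l | _]; rewrite leqNgt; apply/negP => ltBE.
(* With more eigenfunctions in [E] than points in [B], some nonzero combination of them vanishes on
   [B]; it will be shown to vanish everywhere. *)
pose A : 'M[C]_(#|E|, #|B|) := \matrix_(i, j) u (enum_val i) (enum_val j).
have : kermx A != 0.
  rewrite -mxrank_eq0 mxrank_ker subn_eq0 -ltnNge.
  exact: leq_ltn_trans (rank_leq_col _) ltBE.
case/rowV0Pn => v /sub_kermxP vA0; case/negP.
pose f y := \sum_i v 0 i * u (enum_val i) y.
suff f0 y : f y = 0.
  apply/eqP/rowP=> i; rewrite mxE.
  have : dotf f (u (enum_val i)) = 0.
    by rewrite /dotf big1 // => y _; rewrite f0 mul0r.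
  rewrite dotf_suml (bigD1 i) //= dotfZl orth eqxx mulr1 big1 ?addr0 // => j ji.
  by rewrite dotfZl orth (inj_eq enum_val_inj) (negPf ji) mulr0.
apply: (det) y => [k y|y By]; last first.
  have /rowP/(_ (enum_rank_in By y)) := vA0; rewrite !mxE => <-.
  by apply: eq_bigr => i _; rewrite mxE enum_rankK_in.
move: y; set g := kact (a k) f; apply: dotf_eq0.
pose b l := dotf g (u l).
have g_exp y : g y = \sum_l b l * u l y.
  rewrite /b /dotf; under eq_bigr do rewrite mulr_suml.
  rewrite exchange_big (bigD1 y) //=.
  rewrite [X in _ + X]big1 ?addr0 => [|z zy].
    under eq_bigr do rewrite -mulrA [_^* * _]mulrC.
    by rewrite -mulr_sumr compl eqxx mulr1.
  under eq_bigr do rewrite -mulrA [_^* * _]mulrC.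
  by rewrite -mulr_sumr compl eq_sym (negPf zy) mulr0.
(* Since [a k] commutes with [h], it maps eigenfunctions to eigenfunctions of the same eigenvalue,
   and these are orthogonal to [u l] when the eigenvalues differ. *)
have bE l : l \notin E -> b l = 0.
  move=> lE; rewrite /b /g.
  rewrite (eq_dotf (f' := fun y => \sum_i v 0 i * kact (a k) (u (enum_val i)) y)
             (g' := u l)) //; last first.
    by move=> y; rewrite kact_sum; apply: eq_bigr => i _; rewrite kactZ.
  rewrite dotf_suml big1 // => i _; rewrite dotfZl.
  suff /eqP: (d (enum_val i) - d l) * dotf (kact (a k) (u (enum_val i))) (u l) = 0.
    rewrite mulf_eq0 => /orP[|/eqP->]; last by rewrite mulr0.
    rewrite subr_eq0 => /eqP dE; have := enum_valP i.
    by rewrite !inE dE; move: lE; rewrite inE => /negP.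
  rewrite mulrBl -dotfZl.
  rewrite -(eq_dotf (f := kact h (kact (a k) (u (enum_val i)))) (g := u l)) //.
    rewrite dotf_kactC // dotfC.
    rewrite (eq_dotf (f' := fun y => d l * u l y)
       (g' := (kact (a k) (u (enum_val i)))))//.
    rewrite dotfZl rmorphM /= -dotfC (CrealP (d_real l)).
    by rewrite subrr.
  move=> y; rewrite comm -kactZ; apply: eq_kact => z; exact: eig.
have gg : dotf g g = \sum_l b l * (b l)^*.
  rewrite (eq_dotf g_exp (frefl g)) dotf_suml; apply: eq_bigr => l _.
  by rewrite dotfZl (dotfC g).
have hgg : dotf (kact h g) g = \sum_l d l * (b l * (b l)^*).
  have hg y : kact h g y = \sum_l d l * b l * u l y.
    rewrite (eq_kact _ g_exp) kact_sum; apply: eq_bigr => l _.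
    by rewrite kactZ eig mulrA [b l * _]mulrC.
  rewrite (eq_dotf hg (frefl g)) dotf_suml; apply: eq_bigr => l _.
  by rewrite dotfZl (dotfC g) mulrA.
have := form k f; rewrite -/g gg hgg -subr_le0 !mulr_sumr -sumrB => le0.
(* On [E] the factor [s * d l - x] is positive, so a sum that the form bound makes nonpositive
   forces every coefficient [b l] to vanish. *)
have ge0 l : 0 <= s * (d l * (b l * (b l)^*)) - x * (b l * (b l)^*).
  rewrite mulrA -mulrBl; have [lE|/bE->] := boolP (l \in E); last first.
    by rewrite mul0r mulr0.
  apply: mulr_ge0; last exact: mul_conjC_ge0.
  by rewrite subr_ge0 ltW //; move: lE; rewrite inE.
apply: big1 => l _.
have [lE|/bE->] := boolP (l \in E); last by rewrite mul0r.
have sum0 : \sum_l (s * (d l * (b l * (b l)^*)) - x * (b l * (b l)^*)) = 0.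
  by apply: le_anti; rewrite le0 sumr_ge0.
have : s * (d l * (b l * (b l)^*)) - x * (b l * (b l)^*) = 0.
  by apply: (psumr_eq0P _ sum0).
rewrite mulrA -mulrBl => /eqP; rewrite mulf_eq0 => /orP[|/eqP//].
by rewrite subr_eq0 => /eqP e; move: lE; rewrite inE e ltxx.
Qed.

End Spectral.

(** * Traces of even powers, bounded by counting eigenvalues *)

Section Trace.
Variables (C : numClosedFieldType) (T : finType).
Implicit Types (h : T -> T -> C) (f g : T -> C).

Lemma kact_iter_trace h (u : T -> T -> C) (d : T -> C) m :
    (forall l y, kact h (u l) y = d l * u l y) ->
    (forall l k, dotf (u l) (u k) = (l == k)%:R) ->
    (forall y z, \sum_l u l y * (u l z)^* = (y == z)%:R) ->
  \sum_y iter m (kact h) (fun z => (z == y)%:R) y = \sum_l d l ^+ m.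
Proof.
move=> eig orth compl.
have itE y z : iter m (kact h) (fun z => (z == y)%:R) z =
               \sum_l (d l ^+ m * (u l y)^*) * u l z.
  elim: m z => [|m IHm] z /=.
    by rewrite -compl; apply: eq_bigr => l _; rewrite expr0 mul1r mulrC.
  rewrite (eq_kact _ IHm) kact_sum; apply: eq_bigr => l _.
  by rewrite kactZ eig exprS !mulrA [_ * d l]mulrC mulrA.
under eq_bigr do rewrite itE.
rewrite exchange_big; apply: eq_bigr => l _ /=.
under eq_bigr do rewrite -mulrA [_^* * _]mulrC.
by rewrite -mulr_sumr [X in _ * X](orth l l) eqxx mulr1.
Qed.

(** Positive and negative eigenvalues are sorted by absolute value into layers of width [n]. In
    layer [t] the value is at most [n * t.+1], and the layer holds no more eigenvalues than lie
    beyond [n * t]. The vanishing of [b1 n] and [b2 n] leaves only [n] layers. *)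
Lemma sum_even_pow_le (d : T -> C) (n k : nat) (b1 b2 : nat -> nat) :
    (0 < k)%N -> (forall l, d l \is Num.real) ->
    (forall t, #|[set l | ((n * t)%:R < d l)%R]| <= b1 t)%N ->
    (forall t, #|[set l | ((n * t)%:R < - d l)%R]| <= b2 t)%N ->
    b1 n = 0%N -> b2 n = 0%N ->
  \sum_l d l ^+ (2 * k) <=
    (\sum_(t < n) (b1 t + b2 t) * (n * t.+1) ^ (2 * k))%N%:R.
Proof.
move=> k0 d_real le1 le2 b1n b2n.
pose c (e : T -> C) l : C :=
  \sum_(t < n) (((n * t)%:R < e l)%R * (n * t.+1) ^ (2 * k))%N%:R.
have c_ge0 e l : 0 <= c e l by apply: sumr_ge0 => t _; apply: ler0n.
have one (e : T -> C) b l : (forall t, #|[set l | ((n * t)%:R < e l)%R]| <= b t)%N ->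
    b n = 0%N -> 0 < e l -> e l ^+ (2 * k) <= c e l.
  move=> le bn el0.
  have e_le : e l <= (n * n)%:R.
    rewrite real_leNgt ?realn ?(gtr0_real el0) //; apply/negP => lt.
    have := le n; rewrite bn leqn0 cards_eq0 => /eqP/setP/(_ l).
    by rewrite !inE lt.
  have ex : exists t, e l <= (n * t.+1)%:R.
    by exists n; apply: le_trans e_le _; rewrite ler_nat leq_mul2l leqnSn orbT.
  have n_gt0 : (0 < n)%N.
    by case: (n) e_le => // /(lt_le_trans el0); rewrite ltxx.
  case: (ex_minnP ex) => t et tmin.
  have tn : (t < n)%N.
    by rewrite -(prednK n_gt0) ltnS; apply: tmin; rewrite prednK.
  have lt_t : (n * t)%:R < e l.
    case: t et tmin tn => [|t] et tmin tn; first by rewrite muln0.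
    rewrite real_ltNge ?realn ?(gtr0_real el0) //; apply/negP => /tmin.
    by rewrite ltnn.
  rewrite /c (bigD1 (Ordinal tn)) //= lt_t mul1n -[leLHS]addr0 lerD //.
    by rewrite natrX lerXn2r // nnegrE ?ler0n // ltW.
  by apply: sumr_ge0 => i _; apply: ler0n.
have sumc (e : T -> C) b : (forall t, #|[set l | ((n * t)%:R < e l)%R]| <= b t)%N ->
    \sum_l c e l <= (\sum_(t < n) b t * (n * t.+1) ^ (2 * k))%N%:R.
  move=> le; rewrite exchange_big natr_sum; apply: ler_sum => t _.
  rewrite -natr_sum ler_nat -big_distrl leq_mul2r; apply/orP; right.
  apply: leq_trans (le t); rewrite -sum1_card [leqRHS]big_mkcond; apply: leq_sum => l _.
  by rewrite inE; case: ifP.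
apply: (@le_trans _ _ (\sum_l (c d l + c (fun l => - d l) l))).
  apply: ler_sum => l _; have := d_real l; rewrite realE.
  case/orP; rewrite le_eqVlt => /orP[].
  - by move/eqP<-; rewrite expr0n muln_eq0 /= eqn0Ngt k0 addr_ge0.
  - by move=> dl; rewrite -[leLHS]addr0 lerD // (one d b1).
  - by move/eqP->; rewrite expr0n muln_eq0 /= eqn0Ngt k0 addr_ge0.
  move=> dl; rewrite -[leLHS]add0r lerD // -[d l]opprK.
  rewrite [(- - _) ^+ _]exprM sqrrN -exprM; apply: (one (fun l => - d l) b2) => //.
  by rewrite oppr_gt0.
under [X in _ <= (X)%:R]eq_bigr do rewrite mulnDl.
by rewrite !big_split natrD lerD // sumc.
Qed.

End Trace.

(** * Sums of coloured transpositions *)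

Section ColouredTranspositions.
Variables (C : numClosedFieldType) (n : nat) (K : finType) (k0 : K).
Variables (col : 'I_n -> K) (w : K -> C).
Hypothesis w_ge0 : forall c, 0 <= w c.
Hypothesis w_le1 : forall c, w c <= 1.
Implicit Types (f g : {perm 'I_n} -> C) (p q : 'I_n) (psi phi : {perm 'I_n}).

(* The diagonal entries account for the steps that refresh one coordinate. *)
Definition kappa p q : C :=
  if p == q then (col p == k0)%:R else (col p == col q)%:R * w (col p).

Definition tker psi phi : C :=
  \sum_p \sum_q kappa p q * (phi == tperm p q * psi)%g%:R.

Lemma tkerE f psi :
  kact tker f psi = \sum_p \sum_q kappa p q * f (tperm p q * psi)%g.
Proof.
rewrite /kact /tker; under eq_bigr do rewrite mulr_suml.
rewrite exchange_big; apply: eq_bigr => p _ /=.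
under eq_bigr do rewrite mulr_suml.
rewrite exchange_big; apply: eq_bigr => q _ /=.
rewrite (bigD1 (tperm p q * psi)%g) //= eqxx mulr1 big1 ?addr0 // => phi /negPf->.
by rewrite mulr0 mul0r.
Qed.

Lemma kappa_real p q : kappa p q \is Num.real.
Proof.
by rewrite /kappa; case: ifP => _; rewrite ?realn // realM ?realn // ger0_real.
Qed.

Lemma tker_real psi phi : tker psi phi \is Num.real.
Proof.
rewrite /tker; apply: sum_real => p _; apply: sum_real => q _.
by rewrite realM ?kappa_real ?realn.
Qed.

Lemma tker_sym psi phi : tker psi phi = tker phi psi.
Proof.
apply: eq_bigr => p _; apply: eq_bigr => q _; congr (_ * _%:R).
congr nat_of_bool; apply/eqP/eqP => ->; by rewrite mulgA tperm2 mul1g.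
Qed.

Lemma tker_mulr psi phi rho : tker (psi * rho)%g (phi * rho)%g = tker psi phi.
Proof.
apply: eq_bigr => p _; apply: eq_bigr => q _; congr (_ * _%:R).
by rewrite mulgA (inj_eq (mulIg rho)).
Qed.

(** Invariance under right translation makes all diagonal entries of a power of [tker] equal, so
    that its trace is a multiple of a single entry. *)
Lemma iter_tker_diag m psi :
  iter m (kact tker) (fun phi => (phi == psi)%:R) psi =
  iter m (kact tker) (fun phi => (phi == 1%g)%:R) 1%g.
Proof.
suff H phi : iter m (kact tker) (fun phi => (phi == psi)%:R) (phi * psi)%g =
  iter m (kact tker) (fun phi => (phi == 1%g)%:R) phi by rewrite -{2}[psi]mul1g H.
elim: m phi => [|m IHm] phi /=.
  by rewrite -{2}[psi]mul1g (inj_eq (mulIg psi)).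
rewrite /kact (reindex_inj (mulIg psi)); apply: eq_bigr => rho _ /=.
by rewrite tker_mulr IHm.
Qed.

(** * Alternating and symmetric averages over classes of positions, and the form bound on their
    ranges *)

Section ClassAverage.
Variable sgn : bool.

(* The alternating averages ([sgn = true]) bound the spectrum from above, the
   symmetric ones ([sgn = false]) bound it from below. *)
Definition echar (s : {perm 'I_n}) : C := (-1) ^+ (sgn && s).
Definition esign : C := if sgn then 1 else -1.

Lemma echarM s t : echar (s * t)%g = echar s * echar t.
Proof. by rewrite /echar odd_permM -signr_addb; case: sgn. Qed.

Lemma echar_tperm p q : p != q -> echar (tperm p q) = - esign.
Proof.
by move=> pq; rewrite /echar /esign odd_tperm pq; case: sgn; rewrite ?opprK.
Qed.

Definition same_class (cl : 'I_n -> nat) p q : bool :=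
  (col p == col q) && (cl p == cl q).

Definition class_perm (cl : 'I_n -> nat) (s : {perm 'I_n}) : bool :=
  [forall p, same_class cl (s p) p].

Definition aker (cl : 'I_n -> nat) psi phi : C :=
  \sum_(s | class_perm cl s) echar s * (phi == s * psi)%g%:R.

Lemma akerE cl f psi :
  kact (aker cl) f psi = \sum_(s | class_perm cl s) echar s * f (s * psi)%g.
Proof.
rewrite /kact /aker; under eq_bigr do rewrite mulr_suml.
rewrite exchange_big; apply: eq_bigr => s _ /=.
rewrite (bigD1 (s * psi)%g) //= eqxx mulr1 big1 ?addr0 // => phi /negPf->.
by rewrite mulr0 mul0r.
Qed.

Lemma class_perm_tperm cl p q s :
  same_class cl p q -> class_perm cl (s * tperm p q)%g = class_perm cl s.
Proof.
case/andP=> /eqP cpq /eqP lpq; apply: eq_forallb => i.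
by rewrite permM /same_class; case: tpermP => [->|->|]; rewrite ?cpq ?lpq.
Qed.

Lemma aker_alt cl f p q psi : p != q -> same_class cl p q ->
  kact (aker cl) f (tperm p q * psi)%g = - esign * kact (aker cl) f psi.
Proof.
move=> pq spq; rewrite !akerE mulr_sumr.
rewrite (reindex_inj (mulIg (tperm p q))) /=.
apply: eq_big => s; first exact: class_perm_tperm.
by move=> _; rewrite echarM echar_tperm // -mulgA (mulgA (tperm p q)) tperm2 mul1g mulrA [_ * - _]mulrC.
Qed.

(** Conjugation by [s] relabels the pair [p], [q], and [kappa] depends only on whether they coincide
    and on their colours, which a class-preserving [s] respects. *)
Lemma aker_comm cl f :
  kact tker (kact (aker cl) f) =1 kact (aker cl) (kact tker f).
Proof.
move=> psi; rewrite tkerE akerE.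
under eq_bigr do (under eq_bigr do rewrite akerE mulr_sumr; rewrite exchange_big).
rewrite exchange_big; apply: eq_bigr => s /forallP cs /=.
rewrite tkerE mulr_sumr (reindex_inj (@perm_inj _ s)).
apply: eq_bigr => p _ /=; rewrite mulr_sumr (reindex_inj (@perm_inj _ s)).
apply: eq_bigr => q _ /=; rewrite mulrCA; congr (_ * (_ * f _)).
  rewrite /kappa (inj_eq perm_inj).
  by have /andP[/eqP-> _] := cs p; have /andP[/eqP-> _] := cs q.
by rewrite -tpermJ mulgA conjgE !mulgA mulgV mul1g.
Qed.

Definition trans_dot g p q : C := dotf (fun psi => g (tperm p q * psi)%g) g.

Lemma dot_tperm f g p q :
  dotf (fun psi => f (tperm p q * psi)%g) g = dotf f (fun psi => g (tperm p q * psi)%g).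
Proof.
rewrite /dotf (reindex_inj (mulgI (tperm p q))); apply: eq_bigr => psi _ /=.
by rewrite mulgA tperm2 mul1g.
Qed.

Lemma tker_dot g : dotf (kact tker g) g = \sum_p \sum_q kappa p q * trans_dot g p q.
Proof.
rewrite (eq_dotf (tkerE g) (frefl g)) dotf_suml; apply: eq_bigr => p _.
by rewrite dotf_suml; apply: eq_bigr => q _; rewrite dotfZl.
Qed.

Lemma esignK : esign * esign = 1.
Proof. by rewrite /esign; case: sgn; rewrite ?mulrNN mulr1. Qed.

Lemma conj_esign : esign^* = esign.
Proof. by rewrite /esign; case: sgn; rewrite ?rmorphN /= rmorph1. Qed.

(* [g - esign * sum_p g o (p q)] is, up to a scalar, the projection of [g] on
   the functions that alternate over the larger class [q |: A]. *)
Lemma class_sum_le g (A : {set 'I_n}) q : q \notin A ->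
    (forall p p' psi, p \in A -> p' \in A -> p != p' ->
       g (tperm p p' * psi)%g = - esign * g psi) ->
  esign * (\sum_(p in A) trans_dot g p q) <= dotf g g.
Proof.
move=> qA alt.
pose h psi := g psi - esign * \sum_(p in A) g (tperm p q * psi)%g.
have h_alt p psi : p \in A -> h (tperm p q * psi)%g = - esign * h psi.
  move=> pA; rewrite /h (bigD1 p) //= [in RHS](bigD1 p) //= mulgA tperm2 mul1g.
  rewrite (eq_bigr (fun p' => - esign * g (tperm p' q * psi)%g)); last first.
    move=> p' /andP[p'A p'p].
    have qp : q != p by apply: contraNneq qA => ->.
    have := tpermJ p q (tperm p' q); rewrite tpermR tpermD // conjgE tpermV => e.
    by rewrite -(alt p p') 1?eq_sym // -e -!mulgA tpermKg.
  rewrite -mulr_sumr; move: (\sum_(i in A | _) _) => S.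
  by rewrite /esign; case: sgn; ring.
have dot_gh : dotf g h = dotf g g - esign * \sum_(p in A) trans_dot g p q.
  rewrite /trans_dot; under eq_bigr do rewrite dot_tperm.
  rewrite /dotf exchange_big mulr_sumr -sumrB; apply: eq_bigr => psi _ /=.
  by rewrite /h rmorphB rmorphM /= conj_esign rmorph_sum mulrBr mulrCA mulr_sumr.
(* As [h] alternates under each [tperm p q], every one of the [#|A| + 1] terms of the left factor
   contributes the same [dotf g h], which is therefore nonnegative. *)
have dot_hh : dotf h h = (#|A|.+1)%:R * dotf g h.
  rewrite {1}/h /dotf; under eq_bigr do rewrite mulrBl -mulrA mulr_suml.
  rewrite sumrB -mulr_sumr exchange_big /=.
  rewrite [X in _ - _ * X](eq_bigr (fun _ => - esign * dotf g h)); last first.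
    move=> p pA; rewrite -[LHS]/(dotf _ _) dot_tperm /dotf mulr_sumr.
    by apply: eq_bigr => psi _; rewrite h_alt // rmorphM rmorphN /= conj_esign mulrCA.
  rewrite -/(dotf g h) sumr_const -mulr_natr -natr1; move: (dotf g h) => D.
  by rewrite /esign; case: sgn; ring.
rewrite -subr_ge0 -dot_gh -(pmulr_rge0 _ (ltr0Sn _ #|A|)) -dot_hh.
exact: dotf_ge0.
Qed.

(** The bound holds position by position. Up to the factor [esign], a fixed [x] receives its
    diagonal term, minus [dotf g g] from each other member of its own class, and at most [dotf g g]
    from each of the other [m (col x) - 1] classes of its colour, by [class_sum_le]. *)
Lemma tker_form_le g cl (m : K -> nat) (t : nat) :
    (forall p, cl p < m (col p))%N ->
    (forall p, (col p == k0)%:R * esign + (m (col p))%:R - 1 <= t%:R :> C) ->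
    (forall p q psi, p != q -> same_class cl p q ->
       g (tperm p q * psi)%g = - esign * g psi) ->
  esign * dotf (kact tker g) g <= (n * t)%:R * dotf g g.
Proof.
move=> cl_lt m_le alt; have gg0 := dotf_ge0 g.
rewrite tker_dot mulr_sumr natrM -mulrA mulr_natl.
rewrite -[X in _ *+ X]card_ord -sumr_const; apply: ler_sum => x _.
apply: le_trans (ler_wpM2r gg0 (m_le x)).
rewrite (bigD1 x) //= {1}/kappa eqxx mulrDr -addrA [leRHS]mulrDl; apply: lerD.
  rewrite /trans_dot tperm1 (eq_dotf (g' := g) (f' := g)) //.
    by rewrite mulrA [esign * _]mulrC.
  by move=> psi; rewrite mul1g.
have trans_same q : q != x -> same_class cl q x ->
    esign * trans_dot g q x = - dotf g g.
  move=> qx sqx; rewrite /trans_dot (eq_dotf (g' := g)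
    (f' := fun psi => - esign * g psi)) //; last by move=> psi; rewrite alt.
  by rewrite dotfZl mulrA mulrN esignK mulN1r.
have [M mM] : exists M, m (col x) = M.+1.
  by case: (m (col x)) (cl_lt x) => // M _; exists M.
(* The weight [w (col x)] lies between 0 and 1 and the bound is nonnegative, so it is enough to
   treat weight one. *)
suff sum_le : esign * (\sum_(q | (q != x) && (col q == col x)) trans_dot g q x)
                <= M%:R * dotf g g.
  rewrite mM -natr1 addrK.
  rewrite (eq_bigr (fun q => if col q == col x
                             then w (col x) * trans_dot g q x else 0)).
    rewrite -big_mkcondr /= -mulr_sumr mulrCA.
    apply: le_trans (ler_wpM2l (w_ge0 _) sum_le) _.
    by rewrite ler_piMl // mulr_ge0 ?ler0n.
  move=> q qx; rewrite /kappa eq_sym (negPf qx) eq_sym /trans_dot tpermC.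
  by case: eqP; rewrite ?mul1r ?mul0r.
rewrite (partition_big (fun q => inord (cl q) : 'I_M.+1) predT) //=.
rewrite (bigD1 (inord (cl x))) //= mulrDr.
have cl_M q : col q = col x -> (cl q < M.+1)%N by move=> cq; rewrite -mM -cq.
have cl_inord q : col q = col x -> inord (cl q) = inord (cl x) :> 'I_M.+1 ->
    cl q = cl x.
  by move=> cq /(congr1 (@nat_of_ord _)); rewrite !inordK //; apply: cl_M.
rewrite -[leRHS]add0r; apply: lerD.
  rewrite mulr_sumr; apply: sumr_le0 => q /andP[/andP[qx /eqP cq] /eqP iq].
  by rewrite trans_same ?oppr_le0 // /same_class cq cl_inord ?eqxx.
rewrite mulr_sumr.
apply: (@le_trans _ _ (\sum_(a < M.+1 | a != inord (cl x)) dotf g g)); last first.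
  by rewrite sumr_const cardC1 card_ord mulr_natl.
apply: ler_sum => a a_x.
pose A := [set q | [&& q != x, col q == col x & inord (cl q) == a]].
rewrite (eq_bigl (mem A)); last by move=> q; rewrite !inE andbA.
apply: class_sum_le; first by rewrite inE eqxx.
move=> p p' psi; rewrite !inE => /and3P[_ /eqP cp /eqP ip] /and3P[_ /eqP cp' /eqP ip'] pp'.
apply: alt => //; rewrite /same_class cp cp' eqxx /=; apply/eqP.
have := congr1 (@nat_of_ord _) (etrans ip (esym ip')).
by rewrite !inordK //; apply: cl_M.
Qed.

End ClassAverage.

(** * Increasing subsequences inside the colours, and the permutations that determine a function *)

Section Increasing.
Variable psi : {perm 'I_n}.

Definition incr_on (A : {set 'I_n}) : bool :=
  [forall p in A, forall q in A, (p < q)%N ==> (psi p < psi q)%N].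

Lemma incr_onP (A : {set 'I_n}) :
  reflect (forall p q, p \in A -> q \in A -> (p < q)%N -> (psi p < psi q)%N)
          (incr_on A).
Proof.
apply: (iffP forall_inP) => [H p q pA qA|H p pA].
  by have /forall_inP/(_ q qA)/implyP := H p pA.
by apply/forall_inP => q qA; apply/implyP; apply: H.
Qed.

Lemma incr_on_sub (A B : {set 'I_n}) : A \subset B -> incr_on B -> incr_on A.
Proof.
move=> /subsetP AB /incr_onP H; apply/incr_onP => p q /AB pB /AB qB.
exact: H.
Qed.

Definition chain_to p (A : {set 'I_n}) : bool :=
  [&& p \in A, [forall q in A, (col q == col p) && (q <= p)%N] & incr_on A].

(** The label of the Erdős-Szekeres argument: the length of a longest increasing subsequence ending
    at [p], here confined to the colour of [p]. *)
Definition height p : nat := \max_(A | chain_to p A) #|A|.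

Lemma height_gt0 p : (0 < height p)%N.
Proof.
apply: (@leq_trans #|[set p]|); first by rewrite cards1.
apply: (@leq_bigmax_cond _ (chain_to p) (fun A => #|A|)).
rewrite /chain_to set11 /=; apply/andP; split.
  by apply/forall_inP => q; rewrite inE => /eqP->; rewrite eqxx leqnn.
by apply/incr_onP => q r; rewrite !inE => /eqP-> /eqP->; rewrite ltnn.
Qed.

(** A longest chain ending at [p] is prolonged by [q]. Consequently [psi] decreases along positions
    of equal colour and equal height. *)
Lemma height_lt p q : col p = col q -> (p < q)%N -> (psi p < psi q)%N ->
  (height p < height q)%N.
Proof.
move=> cpq pq psipq; rewrite /height.
have [|A] := @eq_bigmax_cond _ (chain_to p) (fun A => #|A|).
  apply/card_gt0P; have := height_gt0 p; rewrite lt0n => h0.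
  have [A chA|no] := pickP (chain_to p); first by exists A.
  by move: h0; rewrite /height big_pred0 ?eqxx.
case/and3P=> pA /forall_inP leA /incr_onP incA ->.
have qA : q \notin A.
  by apply/negP => /leA/andP[_]; rewrite leqNgt pq.
apply: (@leq_trans #|q |: A|); first by rewrite cardsU1 qA.
apply: (@leq_bigmax_cond _ (chain_to q) (fun A => #|A|)).
apply/and3P; split; first by rewrite setU11.
  apply/forall_inP => r /setU1P[->|/leA/andP[/eqP-> rp]].
    by rewrite eqxx leqnn.
  by rewrite cpq eqxx (leq_trans rp) // ltnW.
apply/incr_onP => r1 r2 /setU1P[->|r1A] /setU1P[->|r2A]; first by rewrite ltnn.
- by have /andP[_ r2p] := leA _ r2A; rewrite ltnNge (leq_trans r2p) // ltnW.
- move=> _; have /andP[_] := leA _ r1A; rewrite leq_eqVlt => /orP[/eqP e|r1p].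
    by rewrite (val_inj e).
  exact: ltn_trans (incA _ _ r1A pA r1p) psipq.
exact: incA.
Qed.

End Increasing.

(** Asking for exactly [(m c).+1] positions rather than at least that many changes nothing, since
    subsets of increasing sets are increasing; the union bound then runs over sets of one size. *)
Definition bad_perms (m : K -> nat) : {set {perm 'I_n}} :=
  [set psi | [exists c, exists A : {set 'I_n},
     [&& #|A| == (m c).+1, [forall p in A, col p == c] & incr_on psi A]]].

Lemma subset_of_card (T : finType) (A : {set T}) k :
  (k <= #|A|)%N -> exists2 B : {set T}, B \subset A & #|B| = k.
Proof.
move=> kA; exists [set x in take k (enum A)].
  by apply/subsetP => x; rewrite inE => /mem_take; rewrite mem_enum.
rewrite cardsE (card_uniqP _) ?take_uniq ?enum_uniq // size_takel //.
by rewrite -cardE.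
Qed.

Lemma height_le m psi p : psi \notin bad_perms m -> (height psi p <= m (col p))%N.
Proof.
rewrite inE negb_exists => /forallP/(_ (col p)); rewrite negb_exists => /forallP H.
apply/bigmax_leqP => A /and3P[_ /forall_inP cA iA]; rewrite leqNgt; apply/negP.
case/subset_of_card=> B BA cardB; have := H B; rewrite cardB eqxx /=.
rewrite (incr_on_sub BA iA) andbT; case/negP; apply/forall_inP => q /(subsetP BA).
by move/cA/andP=> [].
Qed.

Definition lexkey psi : n.-tuplelexi 'I_n := [tuple psi i | i < n].

(* A permutation of the positions inside classes along which [psi] decreases
   replaces the first entry that it moves by a smaller one. *)
Lemma lexkey_lt cl psi s :
    (forall p q, same_class cl p q -> (p < q)%N -> (psi q < psi p)%N) ->
    class_perm cl s -> s != 1%g ->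
  (lexkey (s * psi)%g < lexkey psi)%O.
Proof.
move=> decr /forallP cs s1.
have [p0 sp0] : exists p, s p != p.
  apply/existsP; apply: contraNT s1; rewrite negb_exists => /forallP H.
  by apply/eqP/permP => i; rewrite perm1; apply/eqP; move: (H i); rewrite negbK.
have [p sp pmin] := @arg_minnP _ p0 (fun i => s i != i) (fun i => i : nat) sp0.
have fixlt (i : 'I_n) : (i < p)%N -> s i = i.
  by move=> ip; apply/eqP; apply: contraTT ip => /pmin; rewrite -leqNgt.
have psp : (p < s p)%N.
  rewrite ltn_neqAle eq_sym (inj_eq val_inj) sp leqNgt; apply/negP => /fixlt.
  by move/perm_inj/eqP; rewrite (negPf sp).
apply/Order.TupleLexiOrder.ltxi_tuplePlt; exists p => [i ip|].
  by rewrite !tnth_mktuple permM fixlt.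
rewrite !tnth_mktuple permM; apply: decr psp.
by have := cs p; rewrite /same_class ![_ == _ p]eq_sym.
Qed.

(** Take [psi] lexicographically least with [f psi] nonzero. It is not bad, so its heights define
    admissible classes along which it decreases. By [lexkey_lt] all other terms of the average at
    [psi] vanish, and what remains is [f psi]. The signs do not matter here. *)
Lemma aker_determined sgn (m : K -> nat) f :
    (forall cl, (forall p, cl p < m (col p))%N -> kact (aker sgn cl) f =1 fun=> 0) ->
    (forall psi, psi \in bad_perms m -> f psi = 0) ->
  forall psi, f psi = 0.
Proof.
move=> a0 bad0 psi0; apply/eqP; apply: contraT => fpsi0.
have [psi fpsi psi_min] := @arg_minP _ _ _ psi0 (fun psi => f psi != 0) lexkey fpsi0.
have psi_bad : psi \notin bad_perms m by apply: contraNN fpsi => /bad0->.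
pose cl p := (height psi p).-1.
have cl_lt p : (cl p < m (col p))%N.
  by rewrite /cl prednK ?height_gt0 // height_le.
have decr p q : same_class cl p q -> (p < q)%N -> (psi q < psi p)%N.
  case/andP=> /eqP cpq /eqP clpq pq; rewrite ltnNge leq_eqVlt negb_or.
  apply/andP; split.
    by rewrite (inj_eq val_inj) (inj_eq perm_inj) -(inj_eq val_inj) ltn_eqF.
  apply/negP => /(height_lt cpq pq); rewrite -(prednK (height_gt0 psi p)).
  by rewrite -/(cl p) clpq prednK ?height_gt0 // ltnn.
have := a0 cl cl_lt psi; rewrite akerE (bigD1 1%g) /=; last first.
  by apply/forallP => p; rewrite perm1 /same_class !eqxx.
rewrite big1 ?addr0; last first.
  move=> s /andP[cs s1]; have [->|/psi_min] := eqVneq (f (s * psi)%g) 0.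
    by rewrite mulr0.
  by rewrite leNgt (lexkey_lt decr cs s1).
rewrite mul1g /echar odd_perm1 andbF expr0 mul1r => /eqP.
by rewrite (negPf fpsi).
Qed.

(** Rearranging an increasing [psi] by the permutations of [A] gives distinct permutations, and
    different [psi] give disjoint families: the order of the values on [A] recovers the
    rearrangement. *)
Lemma card_incr_on (A : {set 'I_n}) :
  (#|[set psi | incr_on psi A]| * #|A|`! <= n`!)%N.
Proof.
rewrite mulnC -card_perm -(card_Sn n) -cardsT -[#|perm_on A|]cardsE -cardsX.
rewrite -(card_in_imset (f := fun x => (x.1 * x.2)%g)); last first.
  case=> [s psi] [s' psi'] /=; rewrite !inE /= => /andP[sA /incr_onP inc].
  case/andP=> s'A /incr_onP inc' e.
  pose t := (s'^-1 * s)%g.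
  have tA : perm_on A t by rewrite perm_onM ?perm_onV.
  have epsi : psi' = (t * psi)%g by rewrite /t -mulgA e mulKg.
  suff t1 : t = 1%g.
    by move: e; rewrite epsi t1 mul1g => /mulIg->.
  apply/eqP; apply: contraT => t1.
  have [p0 tp0] : exists p, t p != p.
    apply/existsP; apply: contraNT t1; rewrite negb_exists => /forallP H.
    by apply/eqP/permP => i; rewrite perm1; apply/eqP; move: (H i); rewrite negbK.
  (* At the least moved point [p], both [t p] and the preimage [q] of [p] lie beyond [p]; growth of
     [psi'] from [p] to [q] and of [psi] from [p] to [t p] contradict each other. *)
  have [p tp pmin] := @arg_minnP _ p0 (fun i => t i != i) (fun i => i : nat) tp0.
  have moved_gt (q : 'I_n) : t q != q -> q != p -> (p < q)%N.
    by move=> tq qp; rewrite ltn_neqAle pmin // andbT eq_sym.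
  have movedA (q : 'I_n) : t q != q -> q \in A.
    by move=> tq; apply: contraNT tq => qA; rewrite (out_perm tA).
  have ttp : t (t p) != t p by rewrite (inj_eq perm_inj).
  pose q := (t^-1 p)%g.
  have tq : t q = p by rewrite permKV.
  have qp : q != p by apply: contraNneq tp => qp; rewrite -{1}qp tq.
  have tqq : t q != q by rewrite tq eq_sym.
  have := inc' p q (movedA _ tp) (movedA _ tqq) (moved_gt _ tqq qp).
  rewrite epsi !(permM t psi) tq => lt1.
  have := inc p (t p) (movedA _ tp) (movedA _ ttp) (moved_gt _ ttp tp).
  by rewrite ltnNge ltnW.
exact/subset_leq_card/subsetP.
Qed.

Lemma card_bad_perms_le m :
  (#|bad_perms m| <= \sum_c \sum_(A : {set 'I_n} | #|A| == (m c).+1)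
     [forall p in A, col p == c] * (n`! %/ #|A|`!))%N.
Proof.
apply: (@leq_trans (\sum_c \sum_(A : {set 'I_n} | #|A| == (m c).+1)
    \sum_psi [forall p in A, col p == c] * incr_on psi A)%N); last first.
  apply: leq_sum => c _; apply: leq_sum => A _; rewrite -big_distrr leq_mul2l.
  apply/orP; right; rewrite leq_divRL ?fact_gt0 //.
  apply: leq_trans (card_incr_on A); rewrite leq_mul2r; apply/orP; right.
  rewrite -sum1_card [leqRHS]big_mkcond; apply: leq_sum => psi _.
  by rewrite inE; case: incr_on.
under eq_bigr do rewrite exchange_big.
rewrite exchange_big -sum1_card big_mkcond; apply: leq_sum => psi _ /=.
case: ifP => //; rewrite inE => /existsP[c /existsP[A /and3P[cA mA iA]]].
by rewrite (bigD1 c) //= (bigD1 A) //= mA iA.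
Qed.

(* With [level sgn t] classes in each colour the form bound of [tker_form_le] is
   [n * t]: the colour [k0] contributes [esign sgn] on the diagonal, so that one
   class less is available there when [sgn] holds. *)
Definition level (sgn : bool) (t : nat) (c : K) : nat :=
  if sgn && (c == k0) then t else t.+1.

Lemma bad_perms_top sgn : #|bad_perms (level sgn n)| = 0%N.
Proof.
apply/eqP; rewrite cards_eq0 -subset0; apply/subsetP => psi; rewrite inE.
case/existsP=> c /existsP[A /and3P[/eqP cA _ _]].
have := max_card (mem A); rewrite card_ord cA /level.
by case: ifP => _; rewrite ltnNge ?leqnn ?leqnSn.
Qed.

(** The left side is the trace of the power, a sum over eigenvalues. Alternating averages count the
    eigenvalues above [n * t], symmetric ones those below its opposite. At level [n] no permutation
    is bad, as there are only [n] positions. *)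
Lemma tker_trace_le k : (0 < k)%N ->
  n`!%:R * iter (2 * k) (kact tker) (fun phi => (phi == 1%g)%:R) 1%g <=
  (\sum_(t < n) (#|bad_perms (level true t)| + #|bad_perms (level false t)|)
                 * (n * t.+1) ^ (2 * k))%N%:R.
Proof.
move=> k_gt0.
have [u [d [d_real eig orth compl]]] := spectral_basis tker_real tker_sym.
have -> : n`!%:R * iter (2 * k) (kact tker) (fun phi => (phi == 1%g)%:R) 1%g
          = \sum_l d l ^+ (2 * k).
  rewrite -(kact_iter_trace _ eig orth compl).
  under [RHS]eq_bigr do rewrite iter_tker_diag.
  by rewrite sumr_const card_Sn mulr_natl.
have count sgn t :
    (#|[set l | ((n * t)%:R < esign sgn * d l)%R]| <= #|bad_perms (level sgn t)|)%N.
  pose cls := {cl : 'I_n -> nat | forall p, (cl p < level sgn t (col p))%N}.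
  apply: (@card_eigen_gt _ _ tker u d _ _ cls (fun cl => aker sgn (sval cl))) => //.
  - exact: tker_real.
  - exact: tker_sym.
  - by move=> cl f; apply: aker_comm.
  - case=> cl cl_lt f /=; apply: (tker_form_le cl_lt) => [p|p q psi pq spq].
      rewrite /level /esign; case: (sgn); case: eqP => _ /=; rewrite ?mul0r ?mul1r.
      + by rewrite addrAC subrr add0r.
      + by rewrite add0r -natr1 addrK.
      + by rewrite -natr1 [-1 + _]addrC addrK lerBlDr lerDl.
      by rewrite add0r -natr1 addrK.
    exact: aker_alt.
  move=> f a0; apply: aker_determined => cl cl_lt.
  exact: (a0 (exist _ cl cl_lt)).
apply: (@sum_even_pow_le _ _ d n k (fun t => #|bad_perms (level true t)|)
          (fun t => #|bad_perms (level false t)|)) => //; try exact: bad_perms_top.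
  move=> t; apply: leq_trans (count true t).
  by apply/eq_leq/eq_card => l; rewrite !inE mul1r.
move=> t; apply: leq_trans (count false t).
by apply/eq_leq/eq_card => l; rewrite !inE mulN1r.
Qed.

End ColouredTranspositions.

(** * Reduction of the shuffle to the symmetric group *)

Section ShuffleCounts.
Variables (gT : finGroupType) (n : nat).
Implicit Types (p q : 'I_n) (g : gT) (x y : wreath gT n).

(** A step of the walk as a uniform triple: [p = q] refreshes one coordinate (the test [i == p]
    comes first), distinct [p], [q] give a paired flip. The weights of the measure become
    multiplicities [n], 1 and 2. *)
Definition shuffle p q g : wreath gT n :=
  Wreath ([ffun i => if i == p then g else if i == q then g^-1%g else 1%g],
          tperm p q).

Lemma wpermM x y : wperm (x * y)%g = (wperm y * wperm x)%g.
Proof. by []. Qed.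

Lemma wcoordM x y i :
  wcoord (x * y)%g i = (wcoord x i * wcoord y ((wperm x)^-1 i))%g.
Proof. by rewrite /wcoord /= ffunE. Qed.

Lemma wperm1 : wperm (1%g : wreath gT n) = 1%g.
Proof. by []. Qed.

Lemma wcoord1 i : wcoord (1%g : wreath gT n) i = 1%g.
Proof. by rewrite /wcoord /= ffunE. Qed.

Lemma wreath_eqP x y : wcoord x =1 wcoord y -> wperm x = wperm y -> x = y.
Proof.
case: x y => [[u s]] [[v t]] /= uv; rewrite /wperm /= => ->.
by congr (Wreath (_, _)); apply/ffunP.
Qed.

Lemma shuffleV p q g :
  ((shuffle p q g)^-1 = shuffle p q (if p == q then g^-1 else g))%g.
Proof.
apply/eqP; rewrite eq_invg_mul; apply/eqP; apply: wreath_eqP => [i|]; last first.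
  by rewrite wpermM /wperm /= tperm2.
rewrite wcoordM wcoord1 /wperm /= tpermV /wcoord /= !ffunE.
case: (eqVneq p q) => [<-|pq].
  by rewrite tperm1 perm1; case: eqP => _; rewrite ?mulgV ?mulg1 //; case: eqP.
case: tpermP => [->|->|/eqP/negPf ip /eqP/negPf iq].
- by rewrite eqxx eq_sym (negPf pq) eqxx mulgV.
- by rewrite eq_sym (negPf pq) !eqxx mulVg.
by rewrite ip iq mulg1.
Qed.

Definition shuffle_count x : nat := (\sum_p \sum_q \sum_g (x == shuffle p q g))%N.

(** The convolution power with its denominator cleared. Natural values let the spectral bound,
    proved over the algebraic numbers, be read in the real field of the walk. *)
Definition shuffle_count_pow m : wreath gT n -> nat :=
  iter m (fun F x => \sum_h shuffle_count (x * h^-1)%g * F h)%N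
    (fun x => (x == 1%g) : nat).

Lemma shuffle_count_powS m x :
  shuffle_count_pow m.+1 x =
  (\sum_p \sum_q \sum_g shuffle_count_pow m (shuffle p q g * x)%g)%N.
Proof.
rewrite /shuffle_count_pow /= -/(shuffle_count_pow m) /shuffle_count.
under eq_bigr do rewrite big_distrl.
rewrite exchange_big; apply: eq_bigr => p _ /=.
under eq_bigr do rewrite big_distrl.
rewrite exchange_big; apply: eq_bigr => q _ /=.
under eq_bigr do rewrite big_distrl.
rewrite exchange_big /=.
rewrite [RHS](reindex_inj (h := fun g => if p == q then g^-1%g else g)); last first.
  by move=> g h; case: ifP => // _ /invg_inj.
apply: eq_bigr => g _; rewrite -shuffleV.
rewrite (bigD1 ((shuffle p q g)^-1 * x)%g) //= big1 ?addn0.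
  by rewrite invMg invgK mulKVg eqxx mul1n.
move=> h hx; case: eqP => [e|_]; rewrite ?mul0n //.
by case/eqP: hx; rewrite -e invMg invgK mulgKV.
Qed.

End ShuffleCounts.

Arguments shuffle_count_pow : simpl never.

(** * Schur orthogonality and the expansion of the walk in matrix coefficients *)

Section MatrixCoefficients.
Variables (gT : finGroupType) (J : finType) (j0 : J) (deg : J -> nat).
Variable rep : forall j, mx_representation algC [set: gT] (deg j).
Hypothesis rep_irr : forall j, mx_irreducible (rep j).
Hypothesis rep_inj : forall i j, mx_rsim (rep i) (rep j) -> i = j.
Hypothesis deg_triv : deg j0 = 1%N.
Hypothesis rep_triv : forall g, rep j0 g = 1%:M.
Hypothesis rep_reg :
  forall g, \sum_j (deg j)%:R * \tr (rep j g) = #|gT|%:R * (g == 1%g)%:R.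
Implicit Types (i j : J) (g h : gT).

Lemma deg_gt0 i : (0 < deg i)%N.
Proof. by have /mx_irrP[] := rep_irr i. Qed.

(** Schur's lemma: the kernel and the image of an intertwiner are submodules, so a nonzero one is an
    isomorphism. *)
Lemma hom_irr_eq0 i j (Y : 'M[algC]_(deg i, deg j)) :
  (forall g, rep i g *m Y = Y *m rep j g) -> i != j -> Y = 0.
Proof.
move=> hom /eqP ij; apply/eqP; apply: contraT => Y0; case: ij.
have /mx_irrP[_ irr_i] := rep_irr i; have /mx_irrP[_ irr_j] := rep_irr j.
have free_Y : row_free Y.
  rewrite -kermx_eq0; apply: contraT => ker0.
  have full : row_full (kermx Y).
    apply: irr_i => //; apply/mxmoduleP => g _.
    by apply/sub_kermxP; rewrite -mulmxA hom mulmxA mulmx_ker mul0mx.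
  by case/negP: Y0; rewrite -mxrank_eq0 -(eqmxMfull Y full) mulmx_ker mxrank0.
have full_Y : row_full <<Y>>%MS.
  apply: irr_j; last by rewrite -mxrank_eq0 genmxE mxrank_eq0.
  apply/mxmoduleP => g _; rewrite genmxE (eqmxMr _ (genmxE Y)) -hom.
  exact: submxMl.
have eq_dim : deg i = deg j.
  by move: free_Y full_Y; rewrite /row_free /row_full genmxE => /eqP-> /eqP.
by apply: rep_inj; exists Y => // g _; apply: hom.
Qed.

Lemma irr_cent_scalar i (Y : 'M[algC]_(deg i)) :
  (forall g, rep i g *m Y = Y *m rep i g) -> is_scalar_mx Y.
Proof.
move=> hom; apply: (mx_abs_irr_cent_scalar (rG := rep i)).
  exact/groupC/rep_irr.
by apply/centgmxP => g _.
Qed.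

Definition schur_avg i j (X : 'M[algC]_(deg i, deg j)) :=
  \sum_g rep i g *m X *m rep j g^-1%g.

Lemma schur_avg_hom i j (X : 'M[algC]_(deg i, deg j)) h :
  rep i h *m schur_avg X = schur_avg X *m rep j h.
Proof.
rewrite /schur_avg mulmx_sumr mulmx_suml (reindex_inj (mulgI h^-1%g)) /=.
apply: eq_bigr => g _; rewrite !mulmxA -(repr_mxM (rep i)) ?inE // mulKVg.
by rewrite -[RHS]mulmxA -(repr_mxM (rep j)) ?inE // invMg invgK.
Qed.

Lemma schur_avg_delta i j a b c e :
  \sum_g rep i g a b * rep j g^-1%g c e =
  schur_avg (delta_mx b c : 'M_(deg i, deg j)) a e.
Proof.
rewrite summxE; apply: eq_bigr => g _.
rewrite mxE (bigD1 c) //= big1 ?addr0 => [|k kc].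
  rewrite mxE (bigD1 b) //= big1 ?addr0 => [|k kb]; first by rewrite mxE !eqxx mulr1.
  by rewrite mxE (negPf kb) mulr0.
by rewrite mxE big1 ?mul0r // => l _; rewrite mxE (negPf kc) andbF mulr0.
Qed.

Lemma schur_orth_neq i j a b c e :
  i != j -> \sum_g rep i g a b * rep j g^-1%g c e = 0.
Proof.
by move=> ij; rewrite schur_avg_delta (hom_irr_eq0 (schur_avg_hom _) ij) mxE.
Qed.

(** The average commutes with the representation, hence is scalar; its trace, computed by cyclicity,
    gives the scalar. *)
Lemma schur_orth i a b c e :
  \sum_g rep i g a b * rep i g^-1%g c e =
  #|gT|%:R / (deg i)%:R * (a == e)%:R * (b == c)%:R.
Proof.
rewrite schur_avg_delta; set Y := schur_avg _.
have /is_scalar_mxP[y Yy] : is_scalar_mx Y.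
  by apply: irr_cent_scalar => g; apply: schur_avg_hom.
have deg0 : (deg i)%:R != 0 :> algC by rewrite pnatr_eq0 -lt0n deg_gt0.
have trY : \tr Y = #|gT|%:R * (b == c)%:R.
  rewrite /Y /schur_avg raddf_sum /= (eq_bigr (fun=> (b == c)%:R : algC)).
    by rewrite sumr_const mulr_natl.
  move=> g _; rewrite -mulmxA mxtrace_mulC -mulmxA -(repr_mxM (rep i)) ?inE //.
  rewrite mulVg repr_mx1 mulmx1 /mxtrace (bigD1 b) //= mxE eqxx big1 ?addr0 //.
  by move=> k kb; rewrite mxE (negPf kb).
rewrite Yy mxE -[y *+ _]mulr_natr; move: trY; rewrite Yy mxtrace_scalar -[y *+ _]mulr_natr => trY.
have -> : y = #|gT|%:R * (b == c)%:R / (deg i)%:R by rewrite -trY mulfK.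
by rewrite -!mulrA; congr (_ * _); rewrite [LHS]mulrC -mulrA.
Qed.

Definition coord_index := {j : J & 'I_(deg j)}.
Implicit Types al be ga ep : coord_index.

(** The block diagonal matrix of the direct sum of all [rep j], each taken once, so that
    coefficients of different representations share one index type. *)
Definition mcoef g al be : algC :=
  if tag al == tag be then rep (tag al) g (tagged al) (tagged_as al be) else 0.

Lemma mcoefE g j (a b : 'I_(deg j)) :
  mcoef g (Tagged _ a) (Tagged _ b) = rep j g a b.
Proof. by rewrite /mcoef eqxx tagged_asE. Qed.

Lemma mcoef_neq g al be : tag al != tag be -> mcoef g al be = 0.
Proof. by rewrite /mcoef => /negPf->. Qed.

Lemma mcoef1 al be : mcoef 1%g al be = (al == be)%:R.
Proof.
case: al be => i a [j b]; have [ij|ij] := eqVneq i j; last first.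
  rewrite mcoef_neq //; case: eqP => // e.
  by move: ij; rewrite (congr1 tag e : i = j) eqxx.
by case: _ / ij b => b; rewrite mcoefE repr_mx1 mxE eq_Tagged.
Qed.

Lemma big_coord (F : coord_index -> algC) :
  \sum_al F al = \sum_j \sum_(a < deg j) F (Tagged (fun j => 'I_(deg j)) a).
Proof.
rewrite (@sig_big_dep _ _ _ J (fun j => 'I_(deg j)) xpredT (fun _ _ => true)
          (fun j a => F (Tagged (fun j => 'I_(deg j)) a))).
by apply: eq_bigr => -[j a].
Qed.

Lemma mcoefM g h al be :
  mcoef (g * h)%g al be = \sum_ga mcoef g al ga * mcoef h ga be.
Proof.
case: al be => i a [j b].
rewrite big_coord (bigD1 i) //= [X in _ + X]big1 ?addr0 => [|k ki]; last first.
  by rewrite big1 // => c _; rewrite mcoef_neq ?mul0r //= eq_sym.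
have [ij|ij] := eqVneq i j; last first.
  by rewrite mcoef_neq // big1 // => c _; rewrite [X in _ * X]mcoef_neq ?mulr0.
case: _ / ij b => b; rewrite mcoefE repr_mxM ?inE // mxE.
by apply: eq_bigr => c _; rewrite !mcoefE.
Qed.

Lemma mcoef_orth al be ga ep :
  \sum_g mcoef g al be * mcoef g^-1%g ga ep =
  #|gT|%:R / (deg (tag al))%:R * (tag al == tag ga)%:R
    * (al == ep)%:R * (be == ga)%:R.
Proof.
case: al be ga ep => i a [j b] [k c] [l e] /=.
have [ij|ij] := eqVneq i j; last first.
  rewrite big1 => [|g _]; last by rewrite mcoef_neq ?mul0r.
  have [ik|ik] := eqVneq i k; last by rewrite mulr0 !mul0r.
  have [/(congr1 tag) /= jk|_] := eqVneq (Tagged _ b : coord_index) _; last by rewrite mulr0.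
  by case/eqP: ij; rewrite jk.
have [kl|kl] := eqVneq k l; last first.
  rewrite big1 => [|g _]; last by rewrite [X in _ * X]mcoef_neq ?mulr0.
  have [ik|ik] := eqVneq i k; last by rewrite mulr0 !mul0r.
  have [/(congr1 tag) /= il|_] := eqVneq (Tagged _ a : coord_index) _.
    by case/eqP: kl; rewrite -ik.
  by rewrite mulr0 mul0r.
case: _ / ij b => b; case: _ / kl e => e.
have [ik|ik] := eqVneq i k; last first.
  under eq_bigr do rewrite !mcoefE.
  by rewrite schur_orth_neq // mulr0 !mul0r.
case: _ / ik c e => c e; under eq_bigr do rewrite !mcoefE.
by rewrite schur_orth mulr1 !eq_Tagged.
Qed.

(** Orthogonality exchanges the row indices [al] and [ga]. This is how a paired flip becomes a
    transposition of positions of equal colour, weighted by the inverse degree. *)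
Lemma sum_mcoef_pair (u v : gT) al be ga ep :
  \sum_g mcoef (g * u)%g al be * mcoef (g^-1 * v)%g ga ep =
  #|gT|%:R / (deg (tag al))%:R * (tag al == tag ga)%:R
    * (mcoef u ga be * mcoef v al ep).
Proof.
under eq_bigr => g _.
  rewrite !mcoefM mulr_suml.
  under eq_bigr => mu _.
    rewrite mulr_sumr; under eq_bigr do rewrite mulrACA.
  over.
over.
rewrite exchange_big (bigD1 ga) //= [X in _ + X]big1 ?addr0 => [|mu mu_ga].
  rewrite exchange_big (bigD1 al) //= [X in _ + X]big1 ?addr0 => [|nu nu_al].
    by rewrite -mulr_suml mcoef_orth !eqxx !mulr1.
  by rewrite -mulr_suml mcoef_orth [al == nu]eq_sym (negPf nu_al) mulr0 !mul0r.
rewrite exchange_big big1 // => nu _.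
by rewrite -mulr_suml mcoef_orth (negPf mu_ga) mulr0 mul0r.
Qed.

Lemma sum_mcoef (v : gT) al be :
  \sum_g mcoef (g * v)%g al be = #|gT|%:R * (tag al == j0)%:R * mcoef v al be.
Proof.
have pf : (0 < deg j0)%N by rewrite deg_triv.
(* The coefficient [tau] of the trivial representation is constantly 1; inserting it at the inverse
   of [g] turns the single sum into an orthogonality relation. *)
pose tau : coord_index := Tagged _ (Ordinal pf).
have tau1 g : mcoef g tau tau = 1.
  by rewrite mcoefE rep_triv mxE eqxx.
have tauP al' : tag al' = j0 -> al' = tau.
  case: al' => j a /= ej; case: _ / (esym ej) a => a.
  rewrite /tau; congr (Tagged _ _); apply/val_inj => /=.
  by move: (ltn_ord a); move: (nat_of_ord a) => x; rewrite deg_triv; case: x.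
under eq_bigr => g _.
  rewrite mcoefM; under eq_bigr do rewrite -[X in X * _]mulr1 -(tau1 g^-1%g).
over.
rewrite exchange_big; under eq_bigr do rewrite -mulr_suml mcoef_orth.
have [aj|aj] := eqVneq (tag al) j0.
  rewrite (tauP _ aj) (bigD1 tau) //= !eqxx deg_triv divr1 !mulr1 big1 ?addr0 //.
  by move=> ga /negPf->; rewrite mulr0 mul0r.
rewrite big1 ?mulr0 ?mul0r // => ga _.
by rewrite !mul0r.
Qed.

Lemma sum_mcoef_diag g :
  \sum_al (deg (tag al))%:R * mcoef g al al = #|gT|%:R * (g == 1%g)%:R.
Proof.
rewrite -rep_reg big_coord /=.
apply: eq_bigr => j _; rewrite -mulr_sumr; congr (_ * _).
by apply: eq_bigr => c _; rewrite mcoefE.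
Qed.

Variable n : nat.
Implicit Types (p q : 'I_n) (x : wreath gT n) (psi : {perm 'I_n}).
Implicit Type a : {ffun 'I_n -> coord_index}.

Definition colour a : 'I_n -> J := fun i : 'I_n => tag (a i).
Definition inv_deg j : algC := (deg j)%:R^-1.

(* For fixed [a] and [b] the span of these functions is stable under the walk,
   which only moves [psi] by the operator [tker]. *)
Definition wcoef a (b : {ffun 'I_n -> coord_index}) psi x : algC :=
  (psi == (wperm x)^-1)%g%:R * \prod_(i < n) mcoef (wcoord x i) (a i) (b (psi i)).

(** Only the factors at [p] and [q] depend on [g]. For [p = q] the sum projects on the trivial
    colour; otherwise it exchanges the two row indices, which amounts to composing [psi] with
    [tperm p q]. *)
Lemma sum_wcoef_shuffle a b psi x p q :
  \sum_g wcoef a b psi (shuffle p q g * x)%g =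
  #|gT|%:R * kappa j0 (colour a) inv_deg p q * wcoef a b (tperm p q * psi)%g x.
Proof.
have wpermV g : ((wperm (shuffle p q g * x))^-1 = tperm p q * (wperm x)^-1)%g.
  by rewrite wpermM invMg /wperm /= tpermV.
have psiE g : (psi == (wperm (shuffle p q g * x))^-1)%g =
              (tperm p q * psi == (wperm x)^-1)%g.
  by rewrite wpermV; apply/eqP/eqP => [->|<-]; rewrite tpermKg.
rewrite /wcoef; under eq_bigr do rewrite psiE.
rewrite -mulr_sumr mulrCA; congr (_ * _).
have [<-|pq] := eqVneq p q.
  rewrite tperm1 mul1g (bigD1 p) //=.
  rewrite (eq_bigr (fun g => mcoef (g * wcoord x p)%g (a p) (b (psi p)) *
     \prod_(i < n | i != p) mcoef (wcoord x i) (a i) (b (psi i)))).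
    by rewrite -mulr_suml sum_mcoef /kappa eqxx !mulrA.
  move=> g _; rewrite (bigD1 p) //=; congr (_ * _).
    by rewrite wcoordM /wperm /= tperm1 invg1 perm1 /wcoord /= ffunE eqxx.
  apply: eq_bigr => i /negPf ip; congr (mcoef _ _ _).
  by rewrite wcoordM /wperm /= tperm1 invg1 perm1 {1}/wcoord /= ffunE ip mul1g.
rewrite (bigD1 p) //= (bigD1 q) 1?eq_sym //= !permM tpermL tpermR.
set R := \prod_(i < n | _) _.
rewrite (eq_bigr (fun g => mcoef (g * wcoord x q)%g (a p) (b (psi p)) *
   mcoef (g^-1 * wcoord x p)%g (a q) (b (psi q)) * R)).
  rewrite -mulr_suml sum_mcoef_pair /kappa (negPf pq) /inv_deg /colour.
  by rewrite -!mulrA; congr (_ * _); rewrite !mulrA; congr (_ * _); ring.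
move=> g _; rewrite (bigD1 p) //= (bigD1 q) 1?eq_sym //= mulrA; congr (_ * _ * _).
- by rewrite wcoordM /wperm /= tpermV tpermL {1}/wcoord /= ffunE eqxx.
- rewrite wcoordM /wperm /= tpermV tpermR {1}/wcoord /= ffunE eqxx.
  by rewrite eq_sym (negPf pq).
apply: eq_bigr => i /andP[ip iq].
rewrite wcoordM /wperm /= permM tpermV !tpermD 1?eq_sym //.
by rewrite {1}/wcoord /= ffunE (negPf ip) (negPf iq) mul1g.
Qed.

Definition deg_prod a : nat := (\prod_(i < n) deg (tag (a i)))%N.

Definition tker_pow a m : {perm 'I_n} -> algC :=
  iter m (kact (tker j0 (colour a) inv_deg)) (fun phi => (phi == 1%g)%:R).

(** The point mass at the identity is a product of regular characters, one per coordinate;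
    distributing the product gives the sum over [a]. *)
Lemma wcoef0_sum x :
  \sum_a (deg_prod a)%:R * wcoef a a 1%g x = #|gT|%:R ^+ n * (x == 1%g)%:R.
Proof.
transitivity ((1%g == (wperm x)^-1)%g%:R *
    \sum_(a : {ffun 'I_n -> coord_index})
      \prod_(i < n) ((deg (tag (a i)))%:R * mcoef (wcoord x i) (a i) (a i))).
  rewrite mulr_sumr; apply: eq_bigr => a _.
  rewrite /wcoef /deg_prod natr_prod mulrCA -big_split /=.
  by congr (_ * _); apply: eq_bigr => i _; rewrite perm1.
rewrite -(bigA_distr_bigA
  (fun (i : 'I_n) al => (deg (tag al))%:R * mcoef (wcoord x i) al al)).
under eq_bigr do rewrite sum_mcoef_diag.
rewrite big_split prodr_const card_ord mulrCA; congr (_ * _) => /=.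
have [->|x1] := eqVneq x 1%g.
  by rewrite wperm1 invg1 eqxx mul1r big1 // => i _; rewrite wcoord1 eqxx.
have [wx|] := eqVneq 1%g (wperm x)^-1%g; last by rewrite mul0r.
have [i xi] : exists i : 'I_n, wcoord x i != 1%g.
  apply/existsP; apply: contraNT x1; rewrite negb_exists => /forallP H.
  apply/eqP/wreath_eqP => [i|]; last by rewrite wperm1 -[LHS]invgK -wx invg1.
  by rewrite wcoord1; apply/eqP; rewrite -[_ == _]negbK.
by rewrite (bigD1 i) //= (negPf xi) mul0r mulr0.
Qed.

Lemma sum_tker_wcoef a f x :
  \sum_psi kact (tker j0 (colour a) inv_deg) f psi * wcoef a a psi x =
  \sum_p \sum_q kappa j0 (colour a) inv_deg p q *
     \sum_psi f psi * wcoef a a (tperm p q * psi)%g x.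
Proof.
under eq_bigr do rewrite tkerE mulr_suml.
rewrite exchange_big; apply: eq_bigr => p _ /=.
under eq_bigr do rewrite mulr_suml.
rewrite exchange_big; apply: eq_bigr => q _ /=.
rewrite (reindex_inj (mulgI (tperm p q))) mulr_sumr; apply: eq_bigr => psi _ /=.
by rewrite tpermKg mulrA.
Qed.

Lemma shuffle_count_pow_wcoef m x :
  #|gT|%:R ^+ n * (shuffle_count_pow m x)%:R =
  #|gT|%:R ^+ m *
    \sum_a (deg_prod a)%:R * \sum_psi tker_pow a m psi * wcoef a a psi x.
Proof.
elim: m x => [|m IHm] x.
  rewrite expr0 mul1r -wcoef0_sum; apply: eq_bigr => a _; congr (_ * _).
  rewrite (bigD1 1%g) //= eqxx mul1r big1 ?addr0 // => psi /negPf->.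
  by rewrite mul0r.
transitivity (\sum_p \sum_q \sum_g
    #|gT|%:R ^+ n * (shuffle_count_pow m (shuffle p q g * x)%g)%:R : algC).
  rewrite shuffle_count_powS natr_sum mulr_sumr; apply: eq_bigr => p _.
  rewrite natr_sum mulr_sumr; apply: eq_bigr => q _.
  by rewrite natr_sum mulr_sumr.
transitivity (#|gT|%:R ^+ m.+1 * \sum_p \sum_q \sum_a (deg_prod a)%:R *
   (kappa j0 (colour a) inv_deg p q *
     \sum_psi tker_pow a m psi * wcoef a a (tperm p q * psi)%g x)).
  rewrite mulr_sumr; apply: eq_bigr => p _; rewrite mulr_sumr; apply: eq_bigr => q _.
  under eq_bigr do rewrite IHm.
  rewrite -mulr_sumr exchange_big exprSr -mulrA; congr (_ * _).
  rewrite mulr_sumr; apply: eq_bigr => a _ /=; rewrite -mulr_sumr mulrCA.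
  congr (_ * _); rewrite exchange_big mulrA mulr_sumr /=.
  by apply: eq_bigr => psi _; rewrite -mulr_sumr sum_wcoef_shuffle mulrCA.
congr (_ * _); under eq_bigr do rewrite exchange_big.
rewrite exchange_big; apply: eq_bigr => a _ /=.
rewrite sum_tker_wcoef -/(tker_pow a m).
rewrite mulr_sumr; apply: eq_bigr => p _; by rewrite mulr_sumr.
Qed.

Lemma shuffle_count_pow1 m :
  #|gT|%:R ^+ n * (shuffle_count_pow m (1%g : wreath gT n))%:R =
  #|gT|%:R ^+ m * \sum_a (deg_prod a)%:R * tker_pow a m 1%g.
Proof.
rewrite shuffle_count_pow_wcoef; congr (_ * _); apply: eq_bigr => a _.
congr (_ * _); rewrite (bigD1 1%g) //= big1 ?addr0 => [|psi psi1].
  rewrite /wcoef wperm1 invg1 eqxx mul1r big1 ?mulr1 // => i _.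
  by rewrite wcoord1 perm1 mcoef1 eqxx.
by rewrite /wcoef wperm1 invg1 (negPf psi1) mul0r mulr0.
Qed.

(** Weight of the increasing sets of size [M] in one colour, summed over the colourings: choice of
    the set, number of permutations, and a factor [#|gT|], the sum of squared degrees, for each free
    position. The degree of the colour enters separately. *)
Definition level_weight (M : nat) : nat :=
  'C(n, M) * (n`! %/ M`!) * #|gT| ^ (n - M).

Lemma sum_deg_sq : (\sum_j deg j ^ 2 = #|gT|)%N.
Proof.
apply/eqP; rewrite -(eqr_nat algC) natr_sum; have := rep_reg 1%g.
rewrite eqxx mulr1 => <-; apply/eqP/eq_bigr => j _.
by rewrite repr_mx1 mxtrace1 natrX expr2.
Qed.

Lemma sum_coord_deg (P : pred J) :
  (\sum_(al : coord_index | P (tag al)) deg (tag al) = \sum_(j | P j) deg j ^ 2)%N.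
Proof.
transitivity (\sum_(j | P j) \sum_(c < deg j) deg j)%N; last first.
  by apply: eq_bigr => j _; rewrite sum_nat_const card_ord mulnn.
rewrite (@sig_big_dep _ _ _ J (fun j => 'I_(deg j)) P (fun _ _ => true)
          (fun j c => deg j)).
by apply: eq_bigl => -[j c]; rewrite andbT.
Qed.

Lemma sum_deg_prod_bad_le (m : J -> nat) :
  (\sum_a deg_prod a * #|bad_perms (colour a) m| <=
   \sum_c level_weight (m c).+1 * deg c ^ (2 * (m c).+1))%N.
Proof.
apply: (@leq_trans (\sum_a \sum_c \sum_(A : {set 'I_n} | #|A| == (m c).+1)
   n`! %/ #|A|`! * (deg_prod a * [forall p in A, colour a p == c]))%N).
  apply: leq_sum => a _.
  apply: leq_trans (leq_mul (leqnn _) (card_bad_perms_le (colour a) m)) _.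
  rewrite big_distrr; apply: leq_sum => c _; rewrite big_distrr.
  by apply: leq_sum => A _ /=; rewrite mulnA mulnC.
rewrite exchange_big; apply: leq_sum => c _ /=; rewrite exchange_big /=.
rewrite (eq_bigr (fun _ => n`! %/ (m c).+1`! *
    (deg c ^ (2 * (m c).+1) * #|gT| ^ (n - (m c).+1)))%N).
  rewrite sum_nat_const -cardsE card_draws card_ord /level_weight.
  by rewrite -!mulnA leq_mul2l; apply/orP; right; rewrite [X in (_ * X <= _)%N]mulnC.
move=> A /eqP cA; rewrite -big_distrr cA; congr (_ * _)%N => /=.
transitivity (\sum_(a : {ffun 'I_n -> coord_index}) \prod_(i < n)
    (deg (tag (a i)) * ((i \in A) ==> (tag (a i) == c))))%N.
  apply: eq_bigr => a _; rewrite big_split /=; congr (_ * _)%N.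
  have [/forall_inP H|] := boolP [forall p in A, colour a p == c].
    by rewrite big1 // => i _; case: (boolP (i \in A)) => // /H; rewrite /colour => ->.
  rewrite negb_forall => /existsP[p]; rewrite negb_imply => /andP[pA cp].
  by rewrite (bigD1 p) //= pA /= (negPf cp).
rewrite -(bigA_distr_bigA (fun (i : 'I_n) (al : coord_index) =>
   (deg (tag al) * ((i \in A) ==> (tag al == c)))%N)).
rewrite (bigID (mem A)) /=.
rewrite (eq_bigr (fun _ => deg c ^ 2)%N); last first.
  move=> i iA; rewrite -(big_pred1_eq addn c (fun j => deg j ^ 2)%N) -sum_coord_deg.
  rewrite [RHS]big_mkcond; apply: eq_bigr => al _; rewrite iA /=.
  by case: eqP; rewrite ?muln1 ?muln0.
rewrite [X in (_ * X)%N](eq_bigr (fun _ => #|gT|)); last first.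
  move=> i /negPf iA; rewrite -sum_deg_sq -(sum_coord_deg predT).
  by apply: eq_bigr => al _; rewrite iA muln1.
rewrite !prod_nat_const cA -expnM; congr (_ * _ ^ _)%N.
by rewrite -cA -[X in (X - _)%N](card_ord n) -(cardC (mem A)) addKn.
Qed.

Lemma shuffle_count_pow_le k : (0 < k)%N ->
  (n`! * #|gT| ^ n * shuffle_count_pow (2 * k) (1%g : wreath gT n) <=
   #|gT| ^ (2 * k) * \sum_(t < n) (n * t.+1) ^ (2 * k) *
     (level_weight t.+1 +
      2 * (level_weight t.+2 * (1 + \sum_(j | j != j0) deg j ^ (2 * t.+2)))))%N.
Proof.
move=> k_gt0; rewrite -(ler_nat algC) -mulnA !natrM natrX shuffle_count_pow1.
rewrite mulrCA -natrX ler_wpM2l // mulr_sumr.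
have inv_deg_ge0 j : 0 <= inv_deg j by rewrite invr_ge0.
have inv_deg_le1 j : inv_deg j <= 1 by rewrite invf_le1 ?ltr0n ?ler1n deg_gt0.
apply: (@le_trans _ _ (\sum_a (deg_prod a)%:R *
   (\sum_(t < n) (#|bad_perms (colour a) (level j0 true t)|
                   + #|bad_perms (colour a) (level j0 false t)|)
                 * (n * t.+1) ^ (2 * k))%N%:R)).
  apply: ler_sum => a _; rewrite mulrCA ler_wpM2l //.
  exact: (tker_trace_le j0 (colour a) inv_deg_ge0 inv_deg_le1 k_gt0).
under eq_bigr do rewrite -natrM; rewrite -natr_sum ler_nat.
under eq_bigr do rewrite big_distrr; rewrite exchange_big.
apply: leq_sum => t _ /=.
under eq_bigr do rewrite mulnA mulnDr; rewrite -big_distrl [leqLHS]mulnC leq_mul2l.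
apply/orP; right; rewrite big_split /= mul2n -addnn addnA.
have deg1 M : (deg j0 ^ M = 1)%N by rewrite deg_triv exp1n.
(* At level [t] the alternating count has sets of size [t.+1] in the trivial colour and [t.+2] in
   the others; the symmetric count has [t.+2] throughout. Doubling the second weight covers both. *)
apply: leq_add; apply: leq_trans (sum_deg_prod_bad_le _) _.
  rewrite (bigD1 j0) //= /level eqxx deg1 muln1 leq_add2l mulnDr.
  apply: leq_trans (leq_addl _ _); rewrite big_distrr; apply: leq_sum => j /negPf->.
  by rewrite leqnn.
rewrite (bigD1 j0) //= /level deg1 muln1 mulnDr muln1 leq_add2l big_distrr.
exact: leq_sum.
Qed.

End MatrixCoefficients.

(** * Counting shuffles *)

Lemma irr_shuffle_count_pow_le (gT : finGroupType) (n k : nat) : (0 < k)%N ->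
  (n`! * #|gT| ^ n * shuffle_count_pow (2 * k) (1%g : wreath gT n) <=
   #|gT| ^ (2 * k) * \sum_(t < n) (n * t.+1) ^ (2 * k) *
     (level_weight gT n t.+1 +
      2 * (level_weight gT n t.+2 * (1 + delta_irr gT t.+2))))%N.
Proof.
move=> k_gt0.
pose deg (i : Iirr [set: gT]) : nat := irr_degree (socle_of_Iirr i).
pose rep i : mx_representation algC [set: gT] (deg i) := 'Chi_i.
apply: (@shuffle_count_pow_le gT (Iirr [set: gT]) 0 deg rep) => //.
- by move=> i; apply: socle_irr.
- move=> i j ij; apply: irr_inj; rewrite -!irrRepr.
  by apply/eqP/cfRepr_rsimP.
- by rewrite /deg socle_Iirr0 degree_irr1.
- have H g (V : DecSocleType (regular_repr algC [set: gT]%G)) :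
      V = principal_comp _ -> irr_repr V g = 1%:M.
    by move=> ->; apply: irr1_repr; rewrite ?inE.
  by move=> g; apply: H; apply: socle_Iirr0.
move=> g; have /cfunP/(_ g) := cfReg_sum [set: gT]%G.
rewrite cfRegE cardsT mulr_natr => ->; rewrite sum_cfunE.
apply: eq_bigr => i _; rewrite cfunE irr1_degree -irrRepr cfunE inE.
by rewrite mulr1n.
Qed.

(** * Multiplicities of the shuffles, and symmetry of the counting function *)

Section ShuffleWalk.
Variables (gT : finGroupType) (n : nat).
Local Notation W := (wreath gT n).
Implicit Types (x y : W) (p q : 'I_n).

Lemma card_wreath : #|{: W}| = (#|gT| ^ n * n`!)%N.
Proof.
rewrite -(card_Sn n) -[X in (_ ^ X)%N](card_ord n) -card_ffun -card_prod.
by apply: (bij_eq_card (f := @wcoord_perm gT n)); exists (@Wreath gT n) => -[].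
Qed.

Lemma wcoord_shuffle p q (g : gT) i :
  wcoord (shuffle p q g) i =
  if i == p then g else if i == q then g^-1%g else 1%g.
Proof. by rewrite /wcoord /= ffunE. Qed.

Lemma eq_shuffleE x p q g :
  (x == shuffle p q g) =
  [&& wperm x == tperm p q, g == wcoord x p,
      (p != q) ==> (wcoord x q == (wcoord x p)^-1)%g
    & [forall i, (i != p) && (i != q) ==> (wcoord x i == 1%g)]].
Proof.
apply/eqP/and4P => [->|[/eqP wx /eqP-> /implyP xq /forallP x1]].
  rewrite /wperm /wcoord /= !ffunE !eqxx; split=> //.
    by apply/implyP => pq; rewrite [q == p]eq_sym (negPf pq).
  by apply/forallP => i; apply/implyP => /andP[/negPf ip /negPf iq]; rewrite ffunE ip iq.
apply: wreath_eqP => // i; rewrite wcoord_shuffle.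
have [->//|ip] := eqVneq i p.
have [iq|iq] := eqVneq i q.
  by rewrite iq; apply/eqP/xq; rewrite -iq eq_sym.
by apply/eqP; have := x1 i; rewrite ip iq.
Qed.

Lemma sum_shuffleE x p q :
  (\sum_g (x == shuffle p q g) =
   [&& wperm x == tperm p q,
      (p != q) ==> (wcoord x q == (wcoord x p)^-1)%g
    & [forall i, (i != p) && (i != q) ==> (wcoord x i == 1%g)]])%N.
Proof.
rewrite (bigD1 (wcoord x p)) //= eq_shuffleE eqxx /= big1 ?addn0 // => g.
by rewrite eq_shuffleE => /negPf->; rewrite andbF.
Qed.

Lemma shuffle_count_diag x : wperm x = 1%g ->
  shuffle_count x =
  match #|[set i | wcoord x i != 1%g]| with 0 => n | 1 => 1%N | _ => 0%N end.
Proof.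
move=> wx; set S := [set i | _].
(* Above the identity permutation only pairs [p = q] contribute, each exactly when [x] is supported
   on [p]. *)
have -> : shuffle_count x = (\sum_p (S \subset [set p]))%N.
  apply: eq_bigr => p _; rewrite (bigD1 p) //= [X in (_ + X)%N]big1 ?addn0.
    rewrite sum_shuffleE wx tperm1 !eqxx /=; congr (nat_of_bool _).
    apply/forallP/subsetP => [H i|H i].
      rewrite !inE => xi; have := H i; rewrite andbb (negPf xi) implybF.
      by rewrite negbK.
    by rewrite andbb; apply/implyP => ip; apply: contraNT ip => xi;
      have := H i; rewrite !inE => /(_ xi).
  move=> q qp; rewrite sum_shuffleE wx; case: eqP => //= e.
  have := congr1 (fun s : {perm 'I_n} => s p) e.
  by rewrite perm1 tpermL => pq; rewrite -pq eqxx in qp.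
case E : #|S| => [|[|m]].
- have -> : S = set0 by apply/eqP; rewrite -cards_eq0 E.
  by under eq_bigr do rewrite sub0set; rewrite sum_nat_const card_ord muln1.
- have /cards1P[s ->] : #|S| == 1%N by rewrite E.
  rewrite (bigD1 s) //= subxx big1 // => p ps.
  by rewrite sub1set inE eq_sym (negPf ps).
rewrite big1 // => p _; case: (boolP (S \subset _)) => // /subset_leq_card.
by rewrite cards1 E.
Qed.

Lemma shuffle_count_flip x : wperm x != 1%g ->
  shuffle_count x = (if paired_flip (wcoord x) (wperm x) then 2 else 0)%N.
Proof.
move=> wx; case: ifPn => [|noflip].
  case/existsP=> p /existsP[q /and4P[pq /eqP wpq /forallP x1 /eqP xq]].
  (* Both orderings of the transposed pair produce [x], each for one [g]; hence the numerator 2 of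
     the measure. *)
  have F p' q' : (\sum_g (x == shuffle p' q' g))%N =
                 ((p', q') == (p, q)) || ((p', q') == (q, p)) :> nat.
    rewrite sum_shuffleE wpq; congr (nat_of_bool _); apply/and3P/orP.
      case=> /eqP e _ _.
      have ep := congr1 (fun s : {perm 'I_n} => s p) e.
      have eq := congr1 (fun s : {perm 'I_n} => s q) e.
      rewrite tpermL in ep; rewrite tpermR in eq.
      move: ep eq; rewrite !xpair_eqE; case: tpermP => [->->|->->|_ _ qp].
      - by left; rewrite !eqxx.
      - by right; rewrite !eqxx.
      by rewrite qp eqxx in pq.
    case; rewrite xpair_eqE => /andP[/eqP-> /eqP->]; split=> //.
    - by apply/implyP => _; rewrite xq.
    - by apply/forallP.
    - by rewrite tpermC.
    - by rewrite xq invgK eqxx implybT.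
    by apply/forallP => i; rewrite andbC.
  rewrite /shuffle_count pair_big /=.
  rewrite (eq_bigr (fun r => ((r == (p, q)) || (r == (q, p))) : nat)); last first.
    by case=> p' q' _; apply: F.
  rewrite (bigD1 (p, q)) //= eqxx /= (bigD1 (q, p)) /=; last first.
    by rewrite xpair_eqE negb_and eq_sym pq.
  by rewrite eqxx orbT big1 // => r /andP[/negPf-> /negPf->].
rewrite /shuffle_count big1 // => p _; rewrite big1 // => q _.
rewrite sum_shuffleE; case: and3P => // -[/eqP wpq xq x1].
case/negP: noflip; apply/existsP; exists p; apply/existsP; exists q.
have pq : p != q.
  by apply: contraNneq wx => pq; rewrite wpq pq tperm1.
by rewrite pq wpq eqxx x1; rewrite pq in xq.
Qed.

Lemma shuffle_count_pow0 x : shuffle_count_pow 0%N x = (x == 1%g).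
Proof. by []. Qed.

Lemma shuffle_count_pow_add a b x :
  (\sum_h shuffle_count_pow a (x * h^-1)%g * shuffle_count_pow b h =
   shuffle_count_pow (a + b) x)%N.
Proof.
elim: a x => [|a IHa] x.
  rewrite (bigD1 x) //= mulgV shuffle_count_pow0 eqxx mul1n big1 ?addn0 //.
  move=> h hx; rewrite shuffle_count_pow0; case: eqP => // e.
  by case/eqP: hx; rewrite -[RHS]mul1g -(mulgKV h x) e !mul1g.
rewrite addSn shuffle_count_powS.
under eq_bigr do rewrite shuffle_count_powS big_distrl.
rewrite exchange_big; apply: eq_bigr => p _ /=.
under eq_bigr do rewrite big_distrl.
rewrite exchange_big; apply: eq_bigr => q _ /=.
under eq_bigr do rewrite big_distrl.
rewrite exchange_big; apply: eq_bigr => g _ /=.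
by rewrite -IHa; apply: eq_bigr => h _; rewrite mulgA.
Qed.

Lemma shuffle_count_pow1E x : shuffle_count_pow 1%N x = shuffle_count x.
Proof.
rewrite /shuffle_count_pow /= (bigD1 1%g) //= invg1 mulg1 eqxx muln1.
by rewrite big1 ?addn0 // => h /negPf->; rewrite muln0.
Qed.

Lemma shuffle_count_powSr m x :
  shuffle_count_pow m.+1 x =
  (\sum_p \sum_q \sum_g shuffle_count_pow m (x * (shuffle p q g)^-1)%g)%N.
Proof.
rewrite -addn1 -shuffle_count_pow_add.
under eq_bigr do rewrite shuffle_count_pow1E /shuffle_count big_distrr.
rewrite exchange_big; apply: eq_bigr => p _ /=.
under eq_bigr do rewrite big_distrr.
rewrite exchange_big; apply: eq_bigr => q _ /=.
under eq_bigr do rewrite big_distrr.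
rewrite exchange_big; apply: eq_bigr => g _ /=.
rewrite (bigD1 (shuffle p q g)) //= eqxx muln1 big1 ?addn0 // => h /negPf->.
by rewrite muln0.
Qed.

Lemma shuffle_count_powV m x :
  shuffle_count_pow m x^-1%g = shuffle_count_pow m x.
Proof.
elim: m x => [|m IHm] x; first by rewrite !shuffle_count_pow0 invg_eq1.
rewrite shuffle_count_powS shuffle_count_powSr.
apply: eq_bigr => p _; apply: eq_bigr => q _; apply: eq_bigr => g _.
by rewrite -IHm invMg invgK.
Qed.

(** Symmetry under inversion turns the sum of squares into a convolution evaluated at the
    identity. *)
Lemma shuffle_count_pow_sq m :
  (\sum_(x : W) shuffle_count_pow m x ^ 2 = shuffle_count_pow (2 * m) (1%g : W))%N.
Proof.
rewrite mul2n -addnn -shuffle_count_pow_add; apply: eq_bigr => x _.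
by rewrite mul1g shuffle_count_powV mulnn.
Qed.

Lemma sum_shuffle_count_pow m :
  (\sum_(x : W) shuffle_count_pow m x = (n ^ 2 * #|gT|) ^ m)%N.
Proof.
elim: m => [|m IHm].
  rewrite (bigD1 1%g) //= shuffle_count_pow0 eqxx big1 ?addn0 // => x /negPf x1.
  by rewrite shuffle_count_pow0 x1.
under eq_bigr do rewrite shuffle_count_powS.
rewrite exchange_big /= (eq_bigr (fun=> n * (#|gT| * (n ^ 2 * #|gT|) ^ m)))%N.
  by rewrite sum_nat_const card_ord [RHS]expnS -!mulnn !mulnA.
move=> p _; rewrite exchange_big /= (eq_bigr (fun=> #|gT| * (n ^ 2 * #|gT|) ^ m))%N.
  by rewrite sum_nat_const card_ord.
move=> q _; rewrite exchange_big /= (eq_bigr (fun=> (n ^ 2 * #|gT|) ^ m))%N.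
  by rewrite sum_nat_const.
by move=> g _; rewrite -IHm [RHS](reindex_inj (mulgI (shuffle p q g))).
Qed.

End ShuffleWalk.

(** * Distances *)

Section Distances.
Variables (R : realType) (T : finGroupType).
Implicit Types P Q : T -> R.

(** Cauchy-Schwarz against the constant function, read off from the nonnegative variance. *)
Lemma sum_sqr_le (a : T -> R) : (\sum_x a x) ^+ 2 <= #|T|%:R * \sum_x a x ^+ 2.
Proof.
have T0 : 0 < #|T|%:R :> R by rewrite ltr0n; apply/card_gt0P; exists 1%g.
set S := \sum_x a x; set S2 := \sum_x _.
have : 0 <= \sum_x (#|T|%:R * a x - S) ^+ 2 by apply: sumr_ge0 => x _; apply: sqr_ge0.
have -> : \sum_x (#|T|%:R * a x - S) ^+ 2 = #|T|%:R * (#|T|%:R * S2 - S ^+ 2).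
  transitivity (\sum_x (#|T|%:R ^+ 2 * a x ^+ 2 + (- (2 * #|T|%:R * S) * a x + S ^+ 2))).
    by apply: eq_bigr => x _; ring.
  rewrite !big_split /= -!mulr_sumr sumr_const -/S -/S2 -mulr_natr; ring.
by rewrite pmulr_rge0 // subr_ge0.
Qed.

(** Equal total masses make the discrepancies on [A] and on its complement opposite, so twice either
    is at most the l1 distance; this gives the factor one half. *)
Lemma tv_dist_le_l2 P Q : \sum_x P x = \sum_x Q x ->
  tv_dist P Q <= 2^-1 * Num.sqrt #|T|%:R * l2_dist P Q.
Proof.
move=> PQ; set d := fun x => P x - Q x.
have sumd : \sum_x d x = 0 by rewrite sumrB PQ subrr.
have l1_le : \sum_x `|d x| <= Num.sqrt #|T|%:R * l2_dist P Q.
  rewrite -sqrtrM ?ler0n // -[leLHS]ger0_norm ?sumr_ge0 // -sqrtr_sqr.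
  by rewrite ler_wsqrtr // (sum_sqr_le (fun x => `|d x|)).
rewrite -mulrA; apply: le_trans (ler_wpM2l _ l1_le); last by rewrite invr_ge0.
apply: bigmax_le => [|A _]; first by rewrite mulr_ge0 ?invr_ge0 ?sumr_ge0.
rewrite -sumrB -[X in `|X|]/(\sum_(x in A) d x); have := sumd; rewrite (bigID (mem A)) /= => /eqP.
rewrite addr_eq0 => /eqP dA; rewrite [X in _ <= _ * X](bigID (mem A)) /=.
have h1 : `|\sum_(x in A) d x| <= \sum_(x in A) `|d x| by apply: ler_norm_sum.
have h2 : `|\sum_(x in A) d x| <= \sum_(x | x \notin A) `|d x|.
  by rewrite dA normrN; apply: ler_norm_sum.
lra.
Qed.

End Distances.

(** * The walk as a normalized count, and its return probability *)

Section ShuffleReal.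
Variables (R : realType) (gT : finGroupType) (n : nat).
Hypothesis n_gt0 : (0 < n)%N.
Local Notation W := (wreath gT n).
Local Notation D := ((n ^ 2 * #|gT|)%:R : R).

Lemma card_gT_gt0 : (0 < #|gT|)%N.
Proof. by apply/card_gt0P; exists 1%g. Qed.

Lemma denom_neq0 : D != 0.
Proof. by rewrite pnatr_eq0 -lt0n muln_gt0 expn_gt0 n_gt0 card_gT_gt0. Qed.

Lemma paired_shufflesE (x : W) :
  paired_shuffles R x = (shuffle_count x)%:R / D.
Proof.
have n0 : n%:R != 0 :> R by rewrite pnatr_eq0 -lt0n.
have g0 : #|gT|%:R != 0 :> R by rewrite pnatr_eq0 -lt0n card_gT_gt0.
rewrite /paired_shuffles natrM natrX; case: ifPn => [/eqP wx|wx].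
  rewrite shuffle_count_diag //; case: #|_| => [|[|m]].
  - by field; rewrite n0 g0.
  - by field; rewrite n0 g0.
  by rewrite mul0r.
rewrite shuffle_count_flip //; case: ifP => _; last by rewrite mul0r.
by field; rewrite n0 g0.
Qed.

Lemma convol_powE k (x : W) :
  convol_pow (@paired_shuffles R gT n) k x = (shuffle_count_pow k x)%:R / D ^+ k.
Proof.
elim: k x => [|k IHk] x; first by rewrite expr0 divr1 shuffle_count_pow0.
rewrite /convol_pow iterS -/(convol_pow _ k) /convol exprS invfM mulrCA mulrA.
rewrite [shuffle_count_pow _ _]/= natr_sum mulr_sumr mulr_suml.
apply: eq_bigr => h _; rewrite IHk paired_shufflesE natrM; ring.
Qed.

Lemma wreath_unifE (x : W) : wreath_unif R x = #|{: W}|%:R^-1.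
Proof. by rewrite /wreath_unif card_wreath natrM natrX. Qed.

Lemma sum_convol_pow k : \sum_x convol_pow (@paired_shuffles R gT n) k x = 1.
Proof.
under eq_bigr do rewrite convol_powE; rewrite -mulr_suml -natr_sum.
by rewrite sum_shuffle_count_pow natrX divff // expf_neq0 // denom_neq0.
Qed.

Lemma card_wreath_neq0 : #|{: W}|%:R != 0 :> R.
Proof. by rewrite pnatr_eq0 -lt0n; apply/card_gt0P; exists 1%g. Qed.

Lemma sum_wreath_unif : \sum_(x : W) wreath_unif R x = 1.
Proof.
under eq_bigr do rewrite wreath_unifE.
by rewrite sumr_const -[LHS]mulr_natr mulVf // card_wreath_neq0.
Qed.

(** In the expanded square both measures have mass one, so the cross term and the constant
    contribute -2 and 1. *)
Lemma l2_dist_sq k :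
  #|{: W}|%:R * l2_dist (convol_pow (@paired_shuffles R gT n) k) (@wreath_unif R gT n) ^+ 2
  = #|{: W}|%:R * (shuffle_count_pow (2 * k) (1%g : W))%:R / D ^+ (2 * k) - 1.
Proof.
rewrite /l2_dist sqr_sqrtr; last by apply: sumr_ge0 => x _; apply: exprn_ge0.
have N0 := card_wreath_neq0; set N := #|{: W}|%:R in N0 *.
have c0 : D ^+ k != 0 by rewrite expf_neq0 ?denom_neq0.
have -> : D ^+ (2 * k) = (D ^+ k) ^+ 2 by rewrite -exprM [(2 * k)%N]mulnC.
transitivity (N * \sum_x (((shuffle_count_pow k x) ^ 2)%N%:R / (D ^+ k) ^+ 2
   + (- (2 / N) * convol_pow (@paired_shuffles R gT n) k x + N^-1 ^+ 2))).
  congr (_ * _); apply: eq_bigr => x _.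
  rewrite real_normK ?num_real // wreath_unifE -/N convol_powE natrX.
  by field; rewrite N0 c0.
rewrite !big_split /= -mulr_suml -natr_sum shuffle_count_pow_sq -mulr_sumr.
rewrite sum_convol_pow sumr_const -[N^-1 ^+ 2 *+ _]mulr_natr -/N; field.
by rewrite N0 c0.
Qed.

End ShuffleReal.

(** * Estimates *)

Lemma ffact_le_expn n m : (n ^_ m <= n ^ m)%N.
Proof.
elim: m n => [|m IHm] n; first by rewrite ffactn0.
case: n => // n; rewrite ffactSS expnS leq_mul2l; apply/orP; right.
apply: leq_trans (IHm n) _; case: (posnP m) => [->//|m0].
by rewrite leq_exp2r.
Qed.

(** Two falling factorials [n ^_ J] appear, one from the binomial coefficient times the factorial of
    [J], one from the quotient of factorials; each is at most [n ^ J]. *)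
Lemma level_weight_fact_le (gT : finGroupType) n J : (J <= n)%N ->
  (level_weight gT n (n - J) * J`! <= (n ^ 2 * #|gT|) ^ J)%N.
Proof.
move=> Jn; rewrite /level_weight bin_sub // -ffact_factd // subKn //.
rewrite expnMn -expnM mulnAC leq_mul2r; apply/orP; right.
rewrite mulnAC bin_ffact mul2n -addnn expnD; apply: leq_mul; exact: ffact_le_expn.
Qed.

Lemma delta_irr_le (gT : finGroupType) m n :
  (m <= n)%N -> (delta_irr gT m <= delta_irr gT n)%N.
Proof.
move=> mn; apply: leq_sum => i _; rewrite leq_pexp2l ?leq_mul2l ?mn ?orbT //.
exact: irr_degree_gt0.
Qed.

Section Estimate.
Variable R : realType.

Lemma sum_pow2_fact_le (m : nat) : \sum_(i < m) 2 ^+ i / i`!%:R <= 9 :> R.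
Proof.
have a_ge0 i : 0 <= 2 ^+ i / i`!%:R :> R by rewrite divr_ge0 ?exprn_ge0.
(* From the third term on, the ratio of consecutive terms is at most 2/3. *)
suff H j : \sum_(i < j.+2) 2 ^+ i / i`!%:R + 3 * (2 ^+ j.+2 / (j.+2)`!%:R) <= 9 :> R.
  have : \sum_(i < m.+2) 2 ^+ i / i`!%:R <= 9 :> R.
    by apply: le_trans (H m); rewrite lerDl mulr_ge0.
  apply: le_trans; rewrite !big_ord_recr /= -addrA lerDl addr_ge0 //.
elim: j => [|j IHj].
  (* Equality holds here: the first two terms sum to 3, and three times the third term, the
     geometric bound for the tail, is 6. *)
  by rewrite !big_ord_recr big_ord0 /= !factS fact0; lra.
apply: le_trans IHj; rewrite big_ord_recr /= -addrA lerD2l.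
set a := 2 ^+ j.+2 / _.
have -> : 2 ^+ j.+3 / (j.+3)`!%:R = a * (2 / j.+3%:R) :> R.
  by rewrite /a factS natrM exprSr invfM; ring.
have a0 : 0 <= a by apply: a_ge0.
have : 2 / j.+3%:R <= 2 / 3 :> R.
  by rewrite ler_pM2l // lef_pV2 ?posrE ?ltr0n // ler_nat.
by move=> h; have := ler_wpM2l a0 h; move: (a * (2 / j.+3%:R)) => b; lra.
Qed.

(** * Summation over the layers, with [y] standing for [exp(-2k/n)] and [u] for [exp(-4c)] *)

Variables (gT : finGroupType) (n k : nat) (y u : R).
Hypothesis n_gt0 : (0 < n)%N.
Hypothesis k_gt0 : (0 < k)%N.
Hypothesis y_ge0 : 0 <= y.
Hypothesis pow_le : forall J, (J <= n)%N -> ((n - J)%:R / n%:R) ^+ (2 * k) <= y ^+ J.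
Hypothesis u_ge0 : 0 <= u.
Hypothesis u_le1 : u <= 1.
Hypothesis y_le : y <= u.
Hypothesis yn_le : (n ^ 2 * #|gT|)%:R * y <= 2 * u.
Hypothesis yd_le : (delta_irr gT n)%:R * y <= u.

Let a (i : nat) : R := 2 ^+ i / i`!%:R.

Lemma level_weight_pow_le J : (J <= n)%N ->
  (level_weight gT n (n - J))%:R * y ^+ J <= a J * u ^+ J.
Proof.
move=> Jn; rewrite /a mulrAC ler_pdivlMr ?ltr0n ?fact_gt0 // mulrAC -natrM.
apply: (@le_trans _ _ (((n ^ 2 * #|gT|)%:R * y) ^+ J)).
  by rewrite exprMn ler_wpM2r ?exprn_ge0 // -natrX ler_nat level_weight_fact_le.
by rewrite -exprMn lerXn2r ?nnegrE ?mulr_ge0.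
Qed.

(** The top layer supplies the 1 of the stationary part; the constant is 45 = 9 + 4 * 9, each 9 from
    [sum_pow2_fact_le]. *)
Lemma sum_decay_le (F : nat -> R) m : (0 < m)%N -> F 0%N <= 1 ->
    (forall J, (J.+1 < m)%N -> F J.+1 <= u * (a J.+1 + 4 * a J)) ->
  \sum_(J < m) F J <= 1 + 45 * u.
Proof.
have a_ge0 i : 0 <= a i by rewrite divr_ge0 ?exprn_ge0.
case: m => // m _ F0 FS; rewrite big_ord_recl /=; apply: lerD => //.
apply: (@le_trans _ _ (\sum_(J < m) u * (a J.+1 + 4 * a J))).
  by apply: ler_sum => J _; apply: FS; rewrite ltnS.
rewrite -mulr_sumr mulrC ler_wpM2r // big_split /= -mulr_sumr.
have h1 : \sum_(i < m) a i <= 9 := sum_pow2_fact_le m.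
have := sum_pow2_fact_le m.+1; rewrite big_ord_recl /= => h2.
have h4 : \sum_(i < m) a i.+1 <= 9 by apply: le_trans h2; rewrite lerDr (a_ge0 0%N).
lra.
Qed.

Lemma shuffle_return_le :
  (#|gT| ^ n * n`!)%:R * (shuffle_count_pow (2 * k) (1%g : wreath gT n))%:R
    / (n ^ 2 * #|gT|)%:R ^+ (2 * k) - 1 <= 45 * u.
Proof.
have n0 : n%:R != 0 :> R by rewrite pnatr_eq0 -lt0n.
have g0 : (0 < #|gT|)%N by apply/card_gt0P; exists 1%g.
have D0 : 0 < (n ^ 2 * #|gT|)%:R ^+ (2 * k) :> R.
  by rewrite exprn_gt0 // ltr0n muln_gt0 expn_gt0 n_gt0.
pose Z := level_weight gT n; pose z M : R := (Z M)%:R.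
pose e M : R := (delta_irr gT M)%:R.
have key (L d : nat -> nat) t :
    (#|gT| ^ (2 * k) * ((n * t.+1) ^ (2 * k) *
       (L t.+1 + 2 * (L t.+2 * (1 + d t.+2)))))%N%:R =
    (t.+1%:R / n%:R) ^+ (2 * k) *
       ((L t.+1)%:R + 2 * ((L t.+2)%:R * (1 + (d t.+2)%:R)))
    * (n ^ 2 * #|gT|)%:R ^+ (2 * k) :> R.
  rewrite !(natrM, natrD) !natrX natrM expr_div_n !exprMn.
  have := expf_neq0 (2 * k) n0.
  move: (n%:R ^+ (2 * k)) (t.+1%:R ^+ (2 * k)) (#|gT|%:R ^+ (2 * k)) => A B E A0.
  by field.
rewrite lerBlDl.
apply: (@le_trans _ _ (\sum_(t < n) (t.+1%:R / n%:R) ^+ (2 * k) *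
     (z t.+1 + 2 * (z t.+2 * (1 + e t.+2))))).
  rewrite ler_pdivrMr // mulr_suml -natrM.
  have := irr_shuffle_count_pow_le gT n k_gt0; rewrite -(ler_nat R).
  rewrite [(n`! * _)%N]mulnC => /le_trans; apply.
  rewrite big_distrr natr_sum le_eqVlt; apply/orP; left; apply/eqP.
  by apply: eq_bigr => t _; apply: key.
(* Layers are now numbered from the top: layer [J] has [t.+1 = n - J]. *)
rewrite (reindex_inj rev_ord_inj) /=.
pose F J : R := ((n - J)%:R / n%:R) ^+ (2 * k) *
   (z (n - J)%N + 2 * (z (n - J).+1 * (1 + e (n - J).+1))).
rewrite (eq_bigr (fun J : 'I_n => F J)); last first.
  by move=> J _; rewrite /F subnSK.
apply: sum_decay_le => // [|J Jn].
  (* In the top layer the weight of size [n] is 1, and that of size [n.+1] is 0 because its binomial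
     coefficient vanishes. *)
  rewrite /F subn0 divff // expr1n mul1r /z /Z /level_weight.
  by rewrite (bin_small (ltnSn n)) binn divnn fact_gt0 subnn mulr0n mul0r mulr0 addr0.
have Jn' : (J <= n)%N by apply: ltnW; apply: ltnW.
rewrite /F -(subSn (ltnW Jn)) subSS.
have z_ge0 M : 0 <= z M by apply: ler0n.
have e_ge0 M : 0 <= e M by apply: ler0n.
apply: (@le_trans _ _ (y ^+ J.+1 *
    (z (n - J.+1)%N + 2 * (z (n - J)%N * (1 + e n))))).
  apply: ler_pM; rewrite ?exprn_ge0 ?divr_ge0 ?addr_ge0 ?mulr_ge0 ?addr_ge0 //.
    exact/pow_le/ltnW.
  by rewrite lerD2l ler_wpM2l // ler_wpM2l // lerD2l ler_nat delta_irr_le ?leq_subr.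
have uX j : u ^+ j <= 1 by rewrite exprn_ile1.
have a_ge0 i : 0 <= a i by rewrite divr_ge0 ?exprn_ge0.
have h1 : z (n - J.+1)%N * y ^+ J.+1 <= a J.+1 * u.
  apply: le_trans (level_weight_pow_le (ltnW Jn)) _.
  by rewrite exprS ler_wpM2l // ler_piMr.
have h2 : z (n - J)%N * y ^+ J <= a J.
  by apply: le_trans (level_weight_pow_le Jn') _; rewrite ler_piMr.
(* Of the [J.+1] factors [y], one pays for the degree sum and the other [J] for the level weight. *)
have h3 : y * (1 + e n) <= 2 * u.
  have eu : e n * y <= u := yd_le.
  rewrite mulrDr mulr1 [y * e n]mulrC mulrDl mul1r; exact: lerD.
have h4 : (z (n - J)%N * y ^+ J) * (y * (1 + e n)) <= a J * (2 * u).
  by apply: ler_pM; rewrite ?mulr_ge0 ?addr_ge0 ?exprn_ge0.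
have -> : y ^+ J.+1 * (z (n - J.+1)%N + 2 * (z (n - J)%N * (1 + e n))) =
   z (n - J.+1)%N * y ^+ J.+1 + 2 * ((z (n - J)%N * y ^+ J) * (y * (1 + e n))).
  by rewrite exprS; ring.
lra.
Qed.

End Estimate.

Theorem theorem3p7p4 (R : realType) :
  exists b : R, 0 < b /\
    forall (gT : finGroupType) (n : nat) (c : R) (k : nat),
      (2 <= #|gT|)%N -> (1 <= n)%N -> 0 < c ->
      k%:R =
        Num.max
          (n%:R * ln n%:R
           + 2^-1 * n%:R * ln (#|gT|%:R - 1)
           + 2^-1 * n%:R * ln ((num_classes gT)%:R - 1))
          (2^-1 * n%:R * ln (delta_irr gT n)%:R)
        + 2 * c * n%:R ->
      let Q : wreath gT n -> R := @paired_shuffles R gT n in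
      let U : wreath gT n -> R := @wreath_unif R gT n in
      tv_dist (convol_pow Q k) U
        <= 2^-1 * Num.sqrt (#|gT|%:R ^+ n * n`!%:R)
             * l2_dist (convol_pow Q k) U
      /\ 2^-1 * Num.sqrt (#|gT|%:R ^+ n * n`!%:R)
             * l2_dist (convol_pow Q k) U
        <= b * expR (- (2 * c)).
Proof.
(* The squared distance will be at most [45 / 4] times [exp(-4c)], which is below the square of
   [4 * exp(-2c)]. *)
exists 4; split=> // gT n c k gT_gt1 n_gt0 c_gt0 kE Q U.
have NE : #|gT|%:R ^+ n * n`!%:R = #|{: wreath gT n}|%:R :> R.
  by rewrite card_wreath natrM natrX.
split.
  by rewrite NE; apply: tv_dist_le_l2; rewrite sum_convol_pow // sum_wreath_unif.
have n0 : 0 < n%:R :> R by rewrite ltr0n.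
have n1 : 1 <= n%:R :> R by rewrite ler1n.
have g1 : 2 <= #|gT|%:R :> R by rewrite ler_nat.
have lnn : 0 <= ln n%:R :> R by apply: ln_ge0.
have lng : 0 <= ln (#|gT|%:R - 1) :> R by apply: ln_ge0; lra.
have lns : 0 <= ln ((num_classes gT)%:R - 1) :> R.
  (* For fewer than two classes the argument is at most 0, where [ln] takes the default value 0. *)
  case: (num_classes gT) => [|[|s]]; first by rewrite ln0 ?sub0r ?oppr_le0.
    by rewrite subrr ln0.
  by apply: ln_ge0; rewrite -natr1 addrK ler1n.
(* Exponentiating the lower bounds [X + 4 * c] and [Y + 4 * c] for the decay rate [r] yields the two
   smallness conditions on [y]. *)
set X : R := 2 * ln n%:R + ln (#|gT|%:R - 1).
set Y : R := ln (delta_irr gT n)%:R.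
set r : R := 2 * k%:R / n%:R.
have rX : X + 4 * c <= r.
  rewrite /r ler_pdivlMr // kE.
  have : n%:R * ln n%:R + 2^-1 * n%:R * ln (#|gT|%:R - 1) <=
    Num.max (n%:R * ln n%:R + 2^-1 * n%:R * ln (#|gT|%:R - 1)
           + 2^-1 * n%:R * ln ((num_classes gT)%:R - 1)) (2^-1 * n%:R * Y).
    by rewrite le_max lerDl !mulr_ge0 ?invr_ge0.
  rewrite /X -/Y; move: (Num.max _ _) => m h.
  have -> : (2 * ln n%:R + ln (#|gT|%:R - 1) + 4 * c) * n%:R =
    2 * (n%:R * ln n%:R + 2^-1 * n%:R * ln (#|gT|%:R - 1)) + 4 * (c * n%:R) by field.
  have -> : 2 * (m + 2 * c * n%:R) = 2 * m + 4 * (c * n%:R) by ring.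
  lra.
have rY : Y + 4 * c <= r.
  rewrite /r ler_pdivlMr // kE -/Y.
  have : 2^-1 * n%:R * Y <=
    Num.max (n%:R * ln n%:R + 2^-1 * n%:R * ln (#|gT|%:R - 1)
           + 2^-1 * n%:R * ln ((num_classes gT)%:R - 1)) (2^-1 * n%:R * Y).
    by rewrite le_max lexx orbT.
  move: (Num.max _ _) => m h.
  have -> : (Y + 4 * c) * n%:R = 2 * (2^-1 * n%:R * Y) + 4 * (c * n%:R) by field.
  have -> : 2 * (m + 2 * c * n%:R) = 2 * m + 4 * (c * n%:R) by ring.
  lra.
have k_gt0 : (0 < k)%N.
  rewrite -(ltr0n R) -(pmulr_rgt0 _ (ltr0Sn R 1)) -(pmulr_lgt0 _ (x := n%:R^-1)).
    by apply: lt_le_trans rX; rewrite /X; lra.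
  by rewrite invr_gt0.
set y : R := expR (- r); set u : R := expR (- (4 * c)).
have expX : expR X = n%:R ^+ 2 * (#|gT|%:R - 1).
  by rewrite /X expRD expRM_natl !lnK // posrE //; lra.
have yX : n%:R ^+ 2 * (#|gT|%:R - 1) * y <= u.
  by rewrite -expX /y /u -expRD ler_expR; lra.
have n21 : 1 <= n%:R ^+ 2 :> R by rewrite exprn_ege1.
have y_ge0 : 0 <= y by apply: expR_ge0.
have y_le : y <= u.
  apply: le_trans yX; rewrite ler_peMl // -[leLHS]mulr1.
  by apply: ler_pM => //; lra.
have yn_le : (n ^ 2 * #|gT|)%:R * y <= 2 * u.
  (* A group of order at least 2 satisfies [#|gT| <= 2 * (#|gT| - 1)], whence the factor 2. *)
  have : 2 * (n%:R ^+ 2 * (#|gT|%:R - 1) * y) <= 2 * u by rewrite ler_wpM2l.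
  apply: le_trans; rewrite natrM natrX.
  have -> : 2 * (n%:R ^+ 2 * (#|gT|%:R - 1) * y) =
            n%:R ^+ 2 * (2 * (#|gT|%:R - 1)) * y by ring.
  by rewrite ler_wpM2r // ler_wpM2l ?exprn_ge0 //; lra.
have yd_le : (delta_irr gT n)%:R * y <= u.
  case: (posnP (delta_irr gT n)) => [->|d0]; first by rewrite mul0r expR_ge0.
  by rewrite -[X in X * _]lnK ?posrE ?ltr0n // /y /u -expRD ler_expR -/Y; lra.
have u_le1 : u <= 1 by rewrite /u expR_le1; lra.
have pow_le J : (J <= n)%N -> ((n - J)%:R / n%:R) ^+ (2 * k) <= y ^+ J.
  move=> Jn.
  have -> : y ^+ J = expR (- (J%:R / n%:R)) ^+ (2 * k).
    rewrite -!expRM_natl /y /r natrM; congr expR; field; exact: lt0r_neq0.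
  apply: lerXn2r; rewrite ?nnegrE ?expR_ge0 ?divr_ge0 //.
  (* The inequality [1 + x <= exp(x)] at [x = -J/n]. *)
  apply: le_trans (expR_ge1Dx _); rewrite natrB // mulrBl divff ?lt0r_neq0 //.
have := @shuffle_return_le R gT n k y u n_gt0 k_gt0 y_ge0 pow_le (expR_ge0 _) u_le1
  y_le yn_le yd_le.
rewrite -card_wreath -l2_dist_sq // -/Q -/U NE => l2_le.
rewrite -(ler_sqr (x := _ * l2_dist _ _)) ?nnegrE ?mulr_ge0 ?invr_ge0 ?sqrtr_ge0 ?expR_ge0 //.
rewrite !exprMn sqr_sqrtr ?ler0n // -expRM_natl.
have -> : 2 * - (2 * c) = - (4 * c) by ring.
have u0 : 0 <= u by apply: expR_ge0.
rewrite -/u -mulrA; lra.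
Qed.
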